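(* Let $P$ be a quasi-Gaussian mixture on $\mathbb R^2$ with $k$ components, means $m_1,\dots,m_k$, weights $\theta_1,\dots,\theta_k$, common variance parameter $\sigma^2$, truncated to $\mathcal B(0,M)$, i.e. with density $$f(x)=\sum_{i=1}^k\frac{\theta_i}{2\pi\sigma^2N_i}e^{-\frac{\|x-m_i\|^2}{2\sigma^2}}\mathbb 1_{\mathcal B(0,M)}(x).$$ Let $\varepsilon\in[0,1]$ be such that $N_i\ge1-\varepsilon$ for $i=1,\dots,k$, let $\tilde B=\inf_{i\ne j}\|m_i-m_j\|$, and assume $\mathcal B(m_i,\tilde B/3)\subset\mathcal B(0,M)$ for all $i=1,\dots,k$. Let $\theta_{min}=\min_i\theta_i$ and $\theta_{max}=\max_i\theta_i$. Assume that $$\frac{\theta_{min}}{\theta_{max}}\ \ge\ \max\left(\frac{2048k\sigma^2}{(1-\varepsilon)\tilde B^2\left(1-e^{-\tilde B^2/2048\sigma^2}\right)},\ \frac{2048k^2M^3}{(1-\varepsilon)7\sigma^2\tilde B\left(e^{\tilde B^2/32\sigma^2}-1\right)}\right).$$ Then $P$ satisfies a margin condition with radius $\frac{\tilde B}{8}$.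
   Context: The weights satisfy $\sum_{i=1}^k\theta_i=1$, and $N_i$ is the normalization constant of the $i$-th truncated Gaussian component, $N_i=\int_{\mathcal B(0,M)}\frac1{2\pi\sigma^2}e^{-\|x-m_i\|^2/(2\sigma^2)}dx$. $\mathcal B(a,r)$ is the closed Euclidean ball with center $a$ and radius $r$. The size of the codebooks is the number $k$ of components. A codebook is $\mathbf c=(c_1,\dots,c_k)\in(\mathbb R^2)^k$; $R(\mathbf c)=\int\min_j\|x-c_j\|^2\,dP(x)$; $\mathcal M$ is the set of minimizers of $R$ over $(\mathbb R^2)^k$. Let $V_i(\mathbf c)=\{x:\|x-c_i\|\le\|x-c_j\|\ \forall j\neq i\}$, $B=\min_{\mathbf c^*\in\mathcal M,\,i\ne j}\|c_i^*-c_j^*\|$, $p_{min}=\min_{\mathbf c^*\in\mathcal M,\,i}P(V_i(\mathbf c^* ))$, $N^*=\bigcup_{\mathbf c^*\in\mathcal M}\bigcup_{i\ne j}V_i(\mathbf c^* )\cap V_j(\mathbf c^* )$, $N^*(t)=\{x:d(x,N^* )\le t\}$, $p(t)=P(N^*(t))$. Margin condition with radius $r_0$: (i) the support of $P$ is included in $\mathcal B(0,M)$; (ii) $\mathcal M$ is finite; (iii) for all $0\le t\le r_0$, $p(t)\le\frac{Bp_{min}}{128M^2}t$. *)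

(* Defs.v *)
From HB Require Import structures.
From mathcomp Require Import all_boot all_order all_algebra.
From mathcomp Require Import all_classical all_reals all_analysis.

Set Implicit Arguments.
Unset Strict Implicit.
Unset Printing Implicit Defensive.

Import Order.TTheory GRing.Theory Num.Theory.
Import numFieldNormedType.Exports.

Local Open Scope classical_set_scope.
Local Open Scope ring_scope.

(* Points of the plane are elements of [R * R].  Measures live on
   [measurableTypeR R * measurableTypeR R], which has the same carrier and the
   Borel sigma-algebra, since this is the type of
   [(lebesgue_measure \x lebesgue_measure)%E]. *)
Notation planeR R := (measurableTypeR R * measurableTypeR R)%type.

Definition lebesgue2 (R : realType) : {measure set (planeR R) -> \bar R} :=
  (@lebesgue_measure R \x @lebesgue_measure R)%E.

(* The library norm on [R * R] is the max norm, hence this definition. *)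
Definition enorm (R : realType) (x : R * R) : R :=
  Num.sqrt (x.1 ^+ 2 + x.2 ^+ 2).

Definition eball (R : realType) (a : R * R) (r : R) : set (R * R) :=
  [set x | enorm (x - a) <= r].

Section vector_quantization.
Variables (R : realType) (k : nat) (P : probability (planeR R) R).

Definition codebook : Type := 'I_k -> R * R.

(* For [0 < k] the minimum over ['I_k] is finite, and [+oo] is neutral. *)
Definition risk (c : codebook) : \bar R :=
  (\int[P]_x \big[mine/+oo]_(j < k) ((enorm ((x : R * R) - c j)) ^+ 2)%:E)%E.

Definition optimal : set codebook :=
  [set c | forall c' : codebook, (risk c <= risk c')%E].

Definition voronoi (c : codebook) (i : 'I_k) : set (R * R) :=
  [set x | forall j, j != i -> enorm (x - c i) <= enorm (x - c j)].

(* [inf] is the real infimum; it is the minimum as soon as [optimal] is finite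
   and nonempty and [1 < k]. *)
Definition sepB : R :=
  inf [set b | exists c i j,
    [/\ optimal c, i != j & b = enorm (c i - c j)]].

Definition pmin : R :=
  inf [set q | exists c i, optimal c /\ q = fine (P (voronoi c i))].

Definition Nstar : set (R * R) :=
  [set x | exists c i j,
    [/\ optimal c, i != j & (voronoi c i `&` voronoi c j) x]].

(* Taken in [\bar R], so that the distance to the empty set is [+oo]. *)
Definition set_dist (x : R * R) (A : set (R * R)) : \bar R :=
  ereal_inf [set (enorm (x - y))%:E | y in A].

Definition Nstar_nbh (t : R) : set (R * R) :=
  [set x | (set_dist x Nstar <= t%:E)%E].

Definition mass_near (t : R) : \bar R := P (Nstar_nbh t).

Definition msupport : set (R * R) :=
  [set x | forall r : R, 0 < r -> (0 < P (eball x r))%E].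

Definition margin_condition (M r0 : R) : Prop :=
  [/\ msupport `<=` eball (0 : R * R) M,
      finite_set optimal &
      forall t : R, 0 <= t <= r0 ->
        (mass_near t <= (sepB * pmin / (128 * M ^+ 2) * t)%:E)%E].

End vector_quantization.

Section quasi_gaussian_mixture.
Variables (R : realType) (k : nat).
Variables (theta : 'I_k -> R) (m : 'I_k -> R * R) (sigma M : R).

Definition truncation_mass (i : 'I_k) : R :=
  \int[lebesgue2 R]_(x in eball (0 : R * R) M)
    ((2 * pi * sigma ^+ 2)^-1 *
     expR (- (enorm ((x : R * R) - m i) ^+ 2 / (2 * sigma ^+ 2)))).

Definition mixture_density (x : R * R) : R :=
  \sum_(i < k) theta i / (2 * pi * sigma ^+ 2 * truncation_mass i) *
    expR (- (enorm (x - m i) ^+ 2 / (2 * sigma ^+ 2))) *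
    \1_(eball (0 : R * R) M) x.

Definition is_quasi_gaussian_mixture (P : probability (planeR R) R) : Prop :=
  forall A : set (planeR R), measurable A ->
    P A = (\int[lebesgue2 R]_(x in A) (mixture_density x)%:E)%E.

(* For [k <= 1] the real [inf] of the empty set is [0]. *)
Definition mean_sep : R :=
  inf [set b | exists i j, i != j /\ b = enorm (m i - m j)].

Definition theta_min : R := inf (range theta).

Definition theta_max : R := sup (range theta).

(* The quotients are taken in [\bar R], where [r / 0 = +oo] for [0 < r]: when
   [eps = 1] or [mean_sep = 0] the threshold is [+oo], whereas division in [R]
   would make it [0]. *)
Definition weight_threshold (eps : R) : \bar R :=
  let B := mean_sep in
  (maxe
    ((2048 * k%:R * sigma ^+ 2)%:E /
     ((1 - eps) * B ^+ 2 * (1 - expR (- (B ^+ 2 / (2048 * sigma ^+ 2)))))%:E)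
    ((2048 * k%:R ^+ 2 * M ^+ 3)%:E /
     ((1 - eps) * 7 * sigma ^+ 2 * B *
      (expR (B ^+ 2 / (32 * sigma ^+ 2)) - 1))%:E))%E.

End quasi_gaussian_mixture.

(* Main.v *)
(* A codebook missing a mean by more than B/16, where B is the separation of the
   means, has larger risk than the codebook of the means themselves; hence every
   optimal codebook is, up to a permutation, within B/16 of the means.  On the
   convex set of such codebooks, the risk at the midpoint of c and c' falls
   below the average risk by a multiple of |c - c'|^2, except for an error
   carried by the points that are close to a bisector of c and at distance at
   least B/4 from every mean.  There the density is tiny, so this region has mass
   proportional to its width, and the risk has only one minimizer near the means.
   The optimal codebooks are thus the permutations of a single one, which leaves
   a single Voronoi boundary to consider, and the same bound on the mass of
   neighborhoods of bisectors gives the margin inequality. *)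
Require Import Defs.
From HB Require Import structures.
From mathcomp Require Import all_boot all_order all_algebra fingroup perm.
From mathcomp Require Import all_classical all_reals all_analysis.
From mathcomp Require Import measurable_realfun ring lra.

Set Implicit Arguments.
Unset Strict Implicit.
Unset Printing Implicit Defensive.

Import Order.TTheory GRing.Theory Num.Theory.
Import numFieldNormedType.Exports.

Local Open Scope classical_set_scope.
Local Open Scope ring_scope.

(** The radius [B / 16] makes the other distances fit. Code points within it of distinct means are
    at least [7 / 8 * B] apart, so a point equidistant from its two nearest code points is at least
    [7 / 16 * B] from all of them and [3 / 8 * B] from all means; moving it by at most [B / 8]
    leaves it at distance at least [B / 4] from the means. Conversely, the balls of radius [B / 4]
    around the means lie in the corresponding cells of every such codebook. Convexity can fail
    because the risk averages a minimum of convex functions. If each code point moves by at most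
    [d], the loss at a bad point is at most [2 * M * d], and the bad points fill a zone whose width
    is itself proportional to [d]. The loss is thus quadratic in [d], like the gain, and only
    constants remain to be compared. Existence of an optimal codebook is not proved: if there is
    none, [Nstar] is empty, and finiteness and the mass inequality hold trivially. *)

(** * Euclidean geometry of the plane *)

Section euclidean_norm.
Variable R : realType.
Implicit Types (x y z a : R * R).

Lemma enorm_ge0 x : 0 <= enorm x.
Proof. exact: sqrtr_ge0. Qed.

Lemma sqr_enorm x : enorm x ^+ 2 = x.1 ^+ 2 + x.2 ^+ 2.
Proof. by rewrite /enorm sqr_sqrtr// addr_ge0// sqr_ge0. Qed.

Lemma sqr_enormB x y :
  enorm (x - y) ^+ 2 = (x.1 - y.1) ^+ 2 + (x.2 - y.2) ^+ 2.
Proof. exact: sqr_enorm. Qed.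

Lemma ler_sqr_enorm x r : 0 <= r -> (enorm x <= r) = (enorm x ^+ 2 <= r ^+ 2).
Proof. by move=> r0; rewrite ler_pXn2r// nnegrE ?enorm_ge0. Qed.

Lemma enorm_distC x y : enorm (x - y) = enorm (y - x).
Proof.
apply/eqP; rewrite -(@eqrXn2 _ 2) ?enorm_ge0//; apply/eqP.
by rewrite !sqr_enormB; ring.
Qed.

Lemma enorm_eq0 x : enorm x = 0 -> x = 0.
Proof.
move=> x0; have := sqr_enorm x; rewrite x0 expr0n/= => /esym/eqP.
rewrite paddr_eq0 ?sqr_ge0// !sqrf_eq0 => /andP[/eqP x10 /eqP x20].
by rewrite [x]surjective_pairing x10 x20.
Qed.

Lemma ler_dot_enorm x y : x.1 * y.1 + x.2 * y.2 <= enorm x * enorm y.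
Proof.
apply: (le_trans (ler_norm _)).
rewrite -(@ler_pXn2r _ 2)// ?nnegrE ?mulr_ge0 ?enorm_ge0//.
rewrite real_normK ?num_real// exprMn !sqr_enorm -subr_ge0.
rewrite (_ : _ - _ = (x.1 * y.2 - x.2 * y.1) ^+ 2); first exact: sqr_ge0.
by ring.
Qed.

Lemma ler_enormD x y : enorm (x + y) <= enorm x + enorm y.
Proof.
rewrite ler_sqr_enorm ?addr_ge0 ?enorm_ge0// sqrrD.
rewrite (sqr_enorm (x + y)) (sqr_enorm x) (sqr_enorm y) /=.
by have := ler_dot_enorm x y; lra.
Qed.

Lemma ler_enorm_distD y x z : enorm (x - z) <= enorm (x - y) + enorm (y - z).
Proof. by rewrite -[x - z](subrKA y) ler_enormD. Qed.

(** The parallelogram identity; its last term is the source of the strict convexity of the risk. *)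
Lemma midpoint_sqr_enorm (x a b : R * R) :
  enorm (x - 2^-1 *: (a + b)) ^+ 2 =
  2^-1 * enorm (x - a) ^+ 2 + 2^-1 * enorm (x - b) ^+ 2 -
  4^-1 * enorm (a - b) ^+ 2.
Proof. by rewrite !sqr_enormB /= /GRing.scale/=; field. Qed.

(** In the factorization of the difference of squares, the difference of the distances is at most
    [d] and their sum at most [4 * M]. *)
Lemma sqr_enorm_sub_le (x a b : R * R) (M d : R) : enorm x <= M ->
  enorm a <= M -> enorm b <= M -> enorm (a - b) <= d ->
  enorm (x - a) ^+ 2 - enorm (x - b) ^+ 2 <= 4 * M * d.
Proof.
move=> xM aM bM abd.
have tri (y : R * R) : enorm y <= M -> enorm (x - y) <= 2 * M.
  move=> yM; have := ler_enorm_distD 0 x y.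
  by rewrite subr0 (enorm_distC 0) subr0; lra.
have := tri a aM; have := tri b bM; rewrite subr_sqr.
have := ler_enorm_distD b x a; rewrite (enorm_distC b a).
have := enorm_ge0 (x - a); have := enorm_ge0 (x - b).
move: (enorm (x - a)) (enorm (x - b)) (enorm (a - b)) abd (enorm_ge0 (a - b)).
move=> p q r rd r0 q0 p0 pqr qM pM.
have d0 : 0 <= d by lra.
apply: (@le_trans _ _ (d * (p + q))); first by apply: ler_wpM2r; lra.
have : d * (p + q) <= d * (4 * M) by apply: ler_wpM2l; lra.
by lra.
Qed.

(** The difference of the squared distances to [a] and [b] is affine in [x], has a gradient of norm
    [2 * enorm (a - b)], and vanishes at [y]. *)
Lemma sqr_enorm_bisector_le (x y a b : R * R) (w : R) :
  enorm (y - a) = enorm (y - b) -> enorm (x - y) <= w ->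
  `|enorm (x - a) ^+ 2 - enorm (x - b) ^+ 2| <= 2 * w * enorm (a - b).
Proof.
move=> yab xyw.
have -> : enorm (x - a) ^+ 2 - enorm (x - b) ^+ 2 =
    2 * ((x - y).1 * (b - a).1 + (x - y).2 * (b - a).2).
  have : enorm (y - a) ^+ 2 = enorm (y - b) ^+ 2 by rewrite yab.
  by rewrite !sqr_enormB /=; lra.
rewrite normrM ger0_norm// -mulrA ler_pM2l//.
apply: (@le_trans _ _ (enorm (x - y) * enorm (a - b))); last first.
  by apply: ler_wpM2r => //; exact: enorm_ge0.
rewrite ler_norml; apply/andP; split; last first.
  by rewrite (enorm_distC a); exact: ler_dot_enorm.
rewrite lerNl; apply: le_trans (ler_dot_enorm _ _).
by rewrite le_eqVlt; apply/orP; left; apply/eqP => /=; ring.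
Qed.

Lemma measurable_enormB a :
  measurable_fun [set: planeR R] (fun x : planeR R => enorm ((x : R * R) - a)).
Proof.
apply: (@measurableT_comp _ _ _ _ _ _ (@Num.sqrt R)).
  by apply: continuous_measurable_fun => x; exact: sqrt_continuous.
by apply: measurable_funD; apply: measurable_funX; apply: measurable_funB.
Qed.

Lemma measurable_eball a r : measurable (eball a r : set (planeR R)).
Proof.
rewrite (_ : eball a r = setT `&`
    (fun x : planeR R => enorm ((x : R * R) - a)) @^-1` `]-oo, r]%classic).
  exact: measurable_enormB.
by rewrite setTI; apply/seteqP; split=> x /=; rewrite in_itv.
Qed.

End euclidean_norm.

(** * Numerical inequalities behind the constants *)

Section real_arithmetic.
Variable R : realType.
Implicit Types t v K e D c q s : R.

(** Used with [v = sigma ^+ 2], [t = theta i], [K = k%:R * tmax], [e = 1 - eps] and [D = B ^+ 2].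
    Dividing by [v] leaves [4 * K <= 5 / 2 * (1 + t)], whereas [1 <= K] and [2 * t <= K] bound the
    right side by [15 / 4 * K]. *)
Lemma heavy_component_absurd v t K e D :
  0 < v -> 0 < t -> 2 * t <= K -> 1 <= K -> 0 < e ->
  2048 * (v * K) <= t * (e * D) ->
  t * (D / 512) <= 5 / 2 * v / e * (1 + t) -> False.
Proof.
move=> v0 t0 tK K1 e0 noise ub.
have ub' : t * (D / 512) * e <= 5 / 2 * v * (1 + t).
  by rewrite -ler_pdivlMr// (le_trans ub)// le_eqVlt; apply/orP; left;
    apply/eqP; ring.
have : v * (4 * K) <= v * (5 / 2 * (1 + t)) by lra.
by rewrite ler_pM2l//; lra.
Qed.

Lemma variance_ratio_le v t K e D : 0 < v -> 0 < t -> 2 * t <= K -> 0 < e ->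
  2048 * (v * K) <= t * (e * D) -> v / e <= D / 4096.
Proof.
move=> v0 t0 tK e0 noise; rewrite ler_pdivrMr// -(ler_pM2l t0).
by have := ler_wpM2l (ltW v0) tK; lra.
Qed.

(** The fraction lost is at most [16 * (5 / 2) / 4096], which is less than [1 / 100]. *)
Lemma chebyshev_arith t c q s v e D : 0 <= t -> 0 < D -> v / e <= D / 4096 ->
  s <= t * (5 / 2 * v / e) -> t * (D / 16) <= c * (D / 16 * q) + s ->
  99 / 100 * t <= c * q.
Proof.
move=> t0 D0 ve sle lb; have D16 : 0 < D / 16 by rewrite divr_gt0.
rewrite -(ler_pM2l D16); have := ler_wpM2l t0 ve.
have tD : 0 <= t * D by rewrite mulr_ge0// ltW.
have e1 : t * (5 / 2 * v / e) = 5 / 2 * (t * (v / e)) by ring.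
by rewrite e1 in sle; lra.
Qed.

Lemma far_sqr_sum (B p q r : R) : 0 < B -> B / 16 < r -> r <= p + q ->
  B ^+ 2 / 512 <= p ^+ 2 + q ^+ 2.
Proof.
move=> B0 Br rpq; have : (B / 16) ^+ 2 <= (p + q) ^+ 2.
  by rewrite ler_pXn2r ?nnegrE//; lra.
by have := sqr_ge0 (p - q); rewrite !expr2; lra.
Qed.

(** The bound [expR (- y) <= 1 / (1 + y)] suffices, since the noise condition and [1 <= K * tmax]
    make [y = B2 / (32 * v)] at least [64 / tmax]. *)
Lemma exp_overlap_le (B2 v tmin tmax K e : R) :
  0 < v -> 0 < tmin -> tmin <= tmax -> 1 <= K * tmax -> 0 < K ->
  0 < e -> e <= 1 ->
  2048 * (v * (K * tmax)) <= tmin * (e * B2) ->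
  expR (- (B2 / (32 * v))) <= tmax / 64.
Proof.
move=> v0 tmin0 tmm Ktmax K0 e0 e1 noise.
have tmax0 : 0 < tmax by exact: lt_le_trans tmm.
have B20 : 0 <= B2.
  rewrite leNgt; apply/negP => B2_lt0; suff : tmin * (e * B2) < 0.
    have : 0 <= v * (K * tmax) by rewrite !mulr_ge0// ltW.
    by lra.
  by rewrite pmulr_rlt0// pmulr_rlt0.
have y_ge : 64 / tmax <= B2 / (32 * v).
  have v32 : 0 < 32 * v by rewrite mulr_gt0.
  rewrite ler_pdivlMr// -mulrAC ler_pdivrMr//.
  have h1 : 2048 * v * K * tmax <= B2 * tmax.
    have : tmin * (e * B2) <= tmax * B2.
      apply: ler_pM => //; [exact: ltW|by rewrite mulr_ge0// ltW|].
      by rewrite ler_piMl.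
    by lra.
  have h2 := ler_wpM2l (ltW v0) Ktmax.
  by lra.
rewrite expRN -[tmax / 64]invf_div lef_pV2 ?posrE ?expR_gt0 ?divr_gt0//.
by rewrite (le_trans y_ge)// (le_trans _ (expR_ge1Dx _))// lerDr.
Qed.

(** A density bound times the area of [K] strips, with [p] standing for [pi]. The crude [2 <= p] is
    enough because [15 / 4 * 150 * 7 / 2048] is about [1.92]. *)
Lemma overlap_mass_le (tmin tmax v e B E p K M w : R) :
  0 <= tmin -> 0 < v -> 0 < e -> 0 <= B -> 0 < E -> 2 <= p -> 0 < M -> 0 <= w ->
  2048 * K * M ^+ 3 * tmax <= tmin * (e * 7 * v * B * E^-1) ->
  5 / 4 * tmax * E / (2 * p * v * e) * (K * (6 * M * w)) <=
  tmin * B / (150 * M ^+ 2) * w.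
Proof.
move=> tmin0 v0 e0 B0 E0 p2 M0 w0 ovl; have p0 : 0 < p by lra.
have pve : 0 < p * v * e by rewrite !mulr_gt0.
have XE : 2048 * (K * tmax * E * M ^+ 3) <= tmin * (e * 7 * v * B).
  rewrite (_ : 2048 * _ = 2048 * K * M ^+ 3 * tmax * E); last by ring.
  by rewrite -ler_pdivlMr// (le_trans ovl)// mulrA.
set X := K * tmax * E in XE.
have -> : 5 / 4 * tmax * E / (2 * p * v * e) * (K * (6 * M * w)) =
    15 / 4 * X * M * w / (p * v * e).
  by rewrite /X; field; rewrite !gt_eqF.
rewrite ler_pdivrMr//.
have -> : tmin * B / (150 * M ^+ 2) * w * (p * v * e) =
    tmin * B * w * p * v * e / (150 * M ^+ 2).
  by field; rewrite !gt_eqF.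
rewrite ler_pdivlMr; last by rewrite mulr_gt0// exprn_gt0.
have := ler_wpM2r w0 XE.
have nn : 0 <= tmin * B * w * v * e by rewrite !mulr_ge0// ltW.
have := ler_wpM2l nn p2.
rewrite (_ : M ^+ 3 = M * M ^+ 2); last by ring.
by lra.
Qed.

(** Both sides are multiples of [t * d ^+ 2]: a gain of [99 / 400] against a loss of [32 / 525]. *)
Lemma contraction_absurd (t d M B : R) : 0 < t -> 0 < d -> 0 < M -> 0 < B ->
  4^-1 * d ^+ 2 * (99 / 100 * t) <=
  2 * M * d * (t * B / (150 * M ^+ 2) * (32 * M * d / (7 * B))) -> False.
Proof.
move=> t0 d0 M0 B0.
have -> : 2 * M * d * (t * B / (150 * M ^+ 2) * (32 * M * d / (7 * B))) =
    32 / 525 * (t * d ^+ 2) by field; rewrite !gt_eqF.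
have : 0 < t * d ^+ 2 by rewrite mulr_gt0// exprn_gt0.
by lra.
Qed.

End real_arithmetic.

Lemma measure_bigsetU_le d (T : measurableType d) (R : realType)
    (mu : {measure set T -> \bar R}) (I : Type) (s : seq I) (F : I -> set T) :
  (forall i, measurable (F i)) ->
  (mu (\big[setU/set0]_(i <- s) F i) <= \sum_(i <- s) mu (F i))%E.
Proof.
move=> mF; elim: s => [|i s IH]; first by rewrite !big_nil measure0.
rewrite !big_cons; apply: le_trans (leeD2l _ IH); apply: measureU2 => //.
exact: bigsetU_measurable.
Qed.

(** * Integration against a measure given by a density *)

Section density.
Context d (T : measurableType d) (R : realType).
Variables (nu : {finite_measure set T -> \bar R}).
Variables (mu : {sigma_finite_measure set T -> \bar R}).
Variables (f : T -> R).
Hypotheses (mf : measurable_fun setT f) (f0 : forall x, 0 <= f x).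
Hypothesis nuE : forall A, measurable A ->
  nu A = (\int[mu]_(x in A) (f x)%:E)%E.

(** The formula for [nu] on sets makes [f] almost everywhere equal to the Radon-Nikodym derivative,
    for which the change of variables holds. *)
Lemma ge0_integral_density (h : T -> \bar R) :
  measurable_fun setT h -> (forall x, 0 <= h x)%E ->
  (\int[nu]_x h x = \int[mu]_x (h x * (f x)%:E))%E.
Proof.
move=> mh h0.
have mEf : measurable_fun setT (EFin \o f) by exact/measurable_EFinP.
have dom : nu `<< mu.
  apply/null_content_dominatesP => A mA muA0; rewrite nuE//.
  by apply: null_set_integral => //; exact: measurable_funTS.
have intf : mu.-integrable setT (EFin \o f).
  apply/integrableP; split=> //.
  under eq_integral do rewrite /= ger0_norm//.
  by rewrite -nuE// ltey_eq fin_num_measure.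
rewrite -(Radon_Nikodym_SigmaFinite.change_of_variables dom h0 measurableT mh).
apply: ae_eq_integral => //.
- apply: emeasurable_funM => //.
  exact: measurable_int (Radon_Nikodym_SigmaFinite.f_integrable dom).
- exact: emeasurable_funM.
apply: ae_eqe_mul2l; apply: integral_ae_eq => //.
  exact: Radon_Nikodym_SigmaFinite.f_integrable.
by move=> A _ mA; rewrite -nuE// -Radon_Nikodym_SigmaFinite.f_integral.
Qed.

End density.

(** * The isotropic Gaussian density on the plane *)

Definition gauss2 (R : realType) (a : R * R) (v : R) (x : R * R) : R :=
  (2 * pi * v)^-1 * expR (- (enorm (x - a) ^+ 2 / (2 * v))).

Section gauss2.
Variable R : realType.
Implicit Types (a : R * R) (v : R).

Lemma gauss2_ge0 a v x : 0 <= v -> 0 <= gauss2 a v x.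
Proof.
by move=> v0; rewrite mulr_ge0 ?expR_ge0// invr_ge0 !mulr_ge0// pi_ge0.
Qed.

Lemma measurable_gauss2 a v :
  measurable_fun [set: planeR R] (gauss2 a v : planeR R -> R).
Proof.
apply: measurable_funM => //; apply: measurableT_comp => //.
apply: measurableT_comp => //; apply: measurable_funM => //.
by apply: measurable_funX; exact: measurable_enormB.
Qed.

Lemma gauss2_normal_pdf a v x : 0 < v ->
  gauss2 a v x = normal_pdf a.1 (Num.sqrt v) x.1 *
                 normal_pdf a.2 (Num.sqrt v) x.2.
Proof.
move=> v0; have sv0 : Num.sqrt v != 0 by rewrite gt_eqF// sqrtr_gt0.
rewrite !normal_pdfE// mulrACA /normal_fun -expRD /normal_peak -invfM -expr2.
have vpi : 0 <= v * pi *+ 2 by rewrite mulrn_wge0// mulr_ge0 ?pi_ge0// ltW.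
rewrite /gauss2 sqr_enormB !(sqr_sqrtr (ltW v0)) (sqr_sqrtr vpi).
congr (_^-1 * expR _); first by ring.
by field; exact: lt0r_neq0.
Qed.

Lemma integral_gauss2 a v : 0 < v ->
  (\int[lebesgue2 R]_x (gauss2 a v x)%:E = 1)%E.
Proof.
move=> v0; rewrite /lebesgue2 fubini_tonelli1//=; last 2 first.
- by apply/measurable_EFinP; exact: measurable_gauss2.
- by move=> x; rewrite lee_fin gauss2_ge0// ltW.
under eq_integral => x _.
  rewrite /fubini_F (_ : (fun _ => _) = (fun y =>
      (normal_pdf a.1 (Num.sqrt v) x)%:E * (normal_pdf a.2 (Num.sqrt v) y)%:E)%E);
    last by apply/funext => y; rewrite gauss2_normal_pdf// EFinM.
  rewrite ge0_integralZl//=; last 3 first.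
  - by apply/measurable_EFinP; exact: measurable_normal_pdf.
  - by move=> y _; rewrite lee_fin normal_pdf_ge0.
  - by rewrite lee_fin normal_pdf_ge0.
  rewrite integral_normal_pdf mule1.
  over.
exact: integral_normal_pdf.
Qed.

End gauss2.

(** * Area of a strip inside a square *)

Section strips.
Variable R : realType.

Lemma lebesgue_measure_itvcc_le (a b : R) : a <= b ->
  (lebesgue_measure `[a, b]%classic = (b - a)%:E)%E.
Proof.
move=> ab; rewrite lebesgue_measure_itv/= lte_fin; case: ifPn => [//|].
by rewrite -leNgt => ba; rewrite (@le_anti _ _ b a) ?ab ?ba// subrr.
Qed.

Lemma slab_length_le (A : set (measurableTypeR R)) (b c r : R) :
  measurable A -> c != 0 -> 0 <= r ->
  (forall y, A y -> `|c * y - b| <= r) ->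
  (lebesgue_measure A <= (2 * (r / `|c|))%:E)%E.
Proof.
move=> mA c0 r0 Asub.
have cr0 : 0 <= r / `|c| by rewrite divr_ge0.
rewrite (_ : 2 * _ = (b / c + r / `|c|) - (b / c - r / `|c|)); last by ring.
rewrite -lebesgue_measure_itvcc_le; last by lra.
apply: le_measure; rewrite ?inE//.
move=> y /Asub /= Ay; rewrite in_itv/= -ler_distl.
by rewrite ler_pdivlMr ?normr_gt0// -normrM mulrBl divfK// [y * c]mulrC.
Qed.

Lemma integral_le_rectangle (phi : measurableTypeR R -> \bar R) (M w : R) :
  0 <= M -> 0 <= w -> measurable_fun setT phi ->
  (forall x, 0 <= phi x)%E -> (forall x, phi x <= w%:E)%E ->
  (forall x, M < `|x| -> phi x = 0%E) ->
  (\int[lebesgue_measure]_x phi x <= (2 * M * w)%:E)%E.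
Proof.
move=> M0 w0 mphi phi0 phiw phiM.
pose I : set (measurableTypeR R) := `[- M, M]%classic.
have mI : measurable I by exact: measurable_itv.
apply: (@le_trans _ _ (\int[lebesgue_measure]_x (w * \1_I x)%:E)%E).
  apply: ge0_le_integral => //.
  - by apply/measurable_EFinP; apply: measurable_funM => //.
  - move=> x _; rewrite indicE; have [xI|] := boolP (x \in I).
      by rewrite mulr1.
    rewrite notin_setE /I/= in_itv/= -ler_norml => /negP; rewrite -ltNge => xM.
    by rewrite phiM// mulr0.
under eq_integral do rewrite EFinM.
rewrite ge0_integralZl//; last first.
- by apply/measurable_EFinP; exact: measurable_indic.
rewrite integral_indic// setIT [X in (_ * X)%E](_ : _ = (M - - M)%:E); last first.
  by apply: lebesgue_measure_itvcc_le; lra.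
by rewrite -EFinM lee_fin; lra.
Qed.

(** For nonzero [n], the last condition says that [x] is within [w] of a line with normal [n]; the
    factor [enorm n] spares normalizing [n]. The square stands in for the disc of radius [M], which
    it contains. *)
Definition box_strip (n : R * R) (a w M : R) : set (R * R) :=
  [set x | [/\ `|x.1| <= M, `|x.2| <= M &
               `|n.1 * x.1 + n.2 * x.2 - a| <= w * enorm n]].

Lemma measurable_box_strip n a w M :
  measurable (box_strip n a w M : set (planeR R)).
Proof.
pose g1 (x : planeR R) := `|x.1|; pose g2 (x : planeR R) := `|x.2|.
pose g3 (x : planeR R) := `|n.1 * x.1 + n.2 * x.2 - a|.
have mg1 : measurable_fun setT g1 by exact: measurableT_comp.
have mg2 : measurable_fun setT g2 by exact: measurableT_comp.
have mg3 : measurable_fun setT g3.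
  apply: measurableT_comp => //; apply: measurable_funB => //.
  by apply: measurable_funD; apply: measurable_funM.
rewrite (_ : box_strip n a w M = (g1 @^-1` `]-oo, M]%classic `&`
  g2 @^-1` `]-oo, M]%classic) `&` g3 @^-1` `]-oo, w * enorm n]%classic).
  by apply: measurableI; [apply: measurableI|];
    rewrite -[X in measurable X]setTI;
    [apply: mg1|apply: mg2|apply: mg3] => //; exact: measurable_itv.
by apply/seteqP; split=> [x [? ? ?]|x [[]]] /=; rewrite !in_itv/=.
Qed.

(* Slicing parallel to the axis along which [n] has its larger coordinate, a
   slice has length at most [2 * sqrt 2 * w <= 3 * w]. *)
Lemma lebesgue2_box_strip_le n a w M : 0 < enorm n -> 0 <= w -> 0 <= M ->
  (lebesgue2 R (box_strip n a w M) <= (6 * M * w)%:E)%E.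
Proof.
move=> n_gt0 w0 M0; have mS := measurable_box_strip n a w M.
have wn0 : 0 <= w * enorm n by rewrite mulr_ge0// ltW.
have slice (c d : R) : `|d| <= `|c| -> enorm n ^+ 2 = c ^+ 2 + d ^+ 2 ->
    c != 0 /\ 2 * (w * enorm n / `|c|) <= 3 * w.
  move=> dc nE.
  have d2c2 : d ^+ 2 <= c ^+ 2 by rewrite -real_normK ?num_real//
    -[leRHS]real_normK ?num_real// ler_pXn2r// nnegrE.
  have c0 : c != 0.
    apply/eqP => c0; move: d2c2 nE; rewrite c0 expr0n/=.
    by have := sqr_ge0 d; have := exprn_gt0 2 n_gt0; lra.
  split=> //; rewrite mulrA ler_pdivrMr ?normr_gt0//.
  have -> : 2 * (w * enorm n) = w * (2 * enorm n) by ring.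
  have -> : 3 * w * `|c| = w * (3 * `|c|) by ring.
  apply: ler_wpM2l => //.
  rewrite -(@ler_pXn2r _ 2)// ?nnegrE ?mulr_ge0 ?enorm_ge0//.
  by rewrite !exprMn real_normK ?num_real// nE; have := sqr_ge0 c; lra.
rewrite (_ : 6 * M * w = 2 * M * (3 * w)); last by ring.
have [n12|/ltW n21] := leP `|n.1| `|n.2|.
  have [|n20 le3] := slice n.2 n.1 n12; first by rewrite sqr_enorm addrC.
  apply: integral_le_rectangle => //.
  - by rewrite mulr_ge0.
  - exact: measurable_fun_xsection.
  - move=> x; rewrite (le_trans _ (_ : (2 * (w * enorm n / `|n.2|))%:E <= _)%E)//.
    apply: (@slab_length_le _ (a - n.1 * x)) => //.
      exact: measurable_xsection.
    move=> y; rewrite /xsection/= inE => -[_ _] /=.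
    by congr (`|_| <= _); ring.
  - move=> x xM /=; rewrite (_ : xsection _ _ = set0) ?measure0//.
    apply/seteqP; split=> // y; rewrite /xsection/= inE => -[/= xM' _ _].
    by move: xM; rewrite ltNge xM'.
have [|n10 le3] := slice n.1 n.2 n21; first by rewrite sqr_enorm.
(* By definition [lebesgue2] integrates the lengths of vertical slices. The product in the other
   order agrees with it on rectangles, hence everywhere, and gives access to horizontal slices. *)
rewrite [leLHS](@product_measure_unique _ _ _ _ R lebesgue_measure
  lebesgue_measure (lebesgue_measure \x^ lebesgue_measure)%E)//; last first.
  by move=> A B mA mB; exact: product_measure2E.
apply: integral_le_rectangle => //.
- by rewrite mulr_ge0.
- exact: measurable_fun_ysection.
- move=> x; rewrite (le_trans _ (_ : (2 * (w * enorm n / `|n.1|))%:E <= _)%E)//.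
  apply: (@slab_length_le _ (a - n.2 * x)) => //.
    exact: measurable_ysection.
  move=> y; rewrite /ysection/= inE => -[_ _] /=.
  by congr (`|_| <= _); ring.
- move=> x xM /=; rewrite (_ : ysection _ _ = set0) ?measure0//.
  apply/seteqP; split=> // y; rewrite /ysection/= inE => -[/= _ xM' _].
  by move: xM; rewrite ltNge xM'.
Qed.

Lemma sigma_finite_lebesgue2 : sigma_finite setT (lebesgue2 R).
Proof.
(* With this unit normal and half-width [i], the strip is the full square of half-side [i]. *)
pose F (i : nat) : set (planeR R) := box_strip (1, 0) 0 i%:R i%:R.
have e1 : enorm (1, 0) = 1 :> R.
  by rewrite /enorm/= expr1n expr0n/= addr0 sqrtr1.
exists F => [|i]; last first.
  split; first exact: measurable_box_strip.
  apply: (@le_lt_trans _ _ (6 * i%:R * i%:R)%:E); last exact: ltry.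
  by apply: lebesgue2_box_strip_le; rewrite ?e1.
apply/seteqP; split=> // x _; pose i := (Num.truncn (`|x.1| + `|x.2|)).+1.
have xi : `|x.1| + `|x.2| < i%:R by exact: truncnS_gt.
exists i => //; rewrite /F /box_strip/= e1 mulr1 mul1r mul0r addr0 subr0.
by have := normr_ge0 x.1; have := normr_ge0 x.2; split; lra.
Qed.

End strips.

(** * Measurability of neighborhoods and Voronoi cells *)

Section measurability.
Variable R : realType.

(* The norm on [R * R] being the max norm, openness is stated with [eball]. *)
Lemma measurable_enorm_open (S : set (R * R)) :
  (forall x, S x -> exists2 e : R, 0 < e & eball x e `<=` S) ->
  measurable (S : set (planeR R)).
Proof.
move=> oS.
pose F (i : rat * rat * rat) : set (planeR R) :=
  let B := eball ((ratr i.1.1, ratr i.1.2) : R * R) (ratr i.2) in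
  if `[< B `<=` S >] then B else set0.
rewrite (_ : S = \bigcup_i F i).
  apply: countable_bigcupT_measurable => // i; rewrite /F.
  by case: ifP => _ //; exact: measurable_eball.
apply/seteqP; split=> [x Sx|x [i _]]; last first.
  by rewrite /F; case: ifPn => // /asboolP; exact.
have [e e0 eS] := oS x Sx.
have [r] := @rat_in_itvoo _ 0 (e / 2) (divr_gt0 e0 (ltr0Sn _ _)).
rewrite in_itv/= => /andP[r0 re].
have itv (u : R) : u - ratr r / 2 < u + ratr r / 2 by lra.
have [p] := rat_in_itvoo (itv x.1); rewrite in_itv/= => /andP[p1 p2].
have [q] := rat_in_itvoo (itv x.2); rewrite in_itv/= => /andP[q1 q2].
have xc : enorm (x - (ratr p, ratr q)) <= ratr r.
  rewrite ler_sqr_enorm ?ltW// sqr_enormB/=.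
  have h (u : R) : - (ratr r / 2) <= u -> u <= ratr r / 2 ->
      u ^+ 2 <= (ratr r / 2) ^+ 2 by move=> *; nra.
  have := h (x.1 - ratr p); have := h (x.2 - ratr q).
  by move=> h1 h2; move: (h1 ltac:(lra) ltac:(lra)) (h2 ltac:(lra) ltac:(lra)); nra.
exists (p, q, r) => //; rewrite /F/=; case: asboolP => //= -[] y /= yc.
apply: eS => /=; have := ler_enorm_distD (ratr p, ratr q) y x.
by rewrite (enorm_distC (ratr p, ratr q) x); move: yc; rewrite /eball/=; lra.
Qed.

Lemma measurable_set_dist_le (A : set (R * R)) (t : R) :
  measurable ([set x | (set_dist x A <= t%:E)%E] : set (planeR R)).
Proof.
rewrite -[X in measurable X]setCK; apply: measurableC.
apply: measurable_enorm_open => x /= /negP; rewrite -ltNge => tx.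
(* A real [s] is interposed because the distance may be [+oo]. The ball of radius [(s - t) / 2]
   around [x] then stays at distance at least [(s + t) / 2 > t] from [A]. *)
have [s ts sx] : exists2 s, t < s & (s%:E <= set_dist x A)%E.
  move: tx; case: (set_dist x A) => [r| |] //=.
    by rewrite lte_fin => tr; exists r.
  by move=> _; exists (t + 1); [lra|rewrite leey].
exists ((s - t) / 2); first by lra.
move=> y /= yx; apply/negP; rewrite -ltNge.
apply: (@lt_le_trans _ _ ((s + t) / 2)%:E); first by rewrite lte_fin; lra.
apply: le_ereal_inf_tmp => _ /= [a Aa <-]; rewrite lee_fin.
have : s <= enorm (x - a).
  by rewrite -lee_fin (le_trans sx)//; apply: ereal_inf_lbound; exists a.
move: yx (ler_enorm_distD y x a); rewrite (enorm_distC x y) /eball/=; lra.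
Qed.

(** The infimum need not be attained, hence the slack [t < u], which is removed by a limit at the
    end. *)
Lemma set_dist_le_ex (A : set (R * R)) (x : R * R) (t u : R) :
  (set_dist x A <= t%:E)%E -> t < u -> exists2 y, A y & enorm (x - y) < u.
Proof.
move=> dx tu; have : (set_dist x A < u%:E)%E by rewrite (le_lt_trans dx) ?lte_fin.
by move/ereal_inf_lt => [_ [y Ay <-]]; rewrite lte_fin; exists y.
Qed.

Lemma measurable_voronoi k (c : 'I_k -> R * R) i :
  measurable (voronoi c i : set (planeR R)).
Proof.
rewrite (_ : voronoi c i = \bigcap_(j in [set j | j != i])
    [set x | enorm (x - c i) <= enorm (x - c j)]); last by [].
apply: fin_bigcap_measurable => [|j _]; first exact: finite_finset.
pose g (x : planeR R) := enorm ((x : R * R) - c i) - enorm ((x : R * R) - c j).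
rewrite (_ : [set x | _] = setT `&` g @^-1` `]-oo, 0]%classic).
  apply: measurable_funB => //; exact: measurable_enormB.
by rewrite setTI; apply/seteqP; split=> x /=; rewrite /g in_itv/= subr_le0.
Qed.

End measurability.

(** * Squared distance to a codebook *)

Section sqdist.
Variables (R : realType) (k : nat).
Implicit Types (c : 'I_k -> R * R) (x : R * R).

(** The integrand of [risk]. *)
Definition sqdist c x : \bar R :=
  \big[mine/+oo%E]_(j < k) ((enorm (x - c j)) ^+ 2)%:E.

Lemma sqdist_le c x j : (sqdist c x <= (enorm (x - c j) ^+ 2)%:E)%E.
Proof. exact: bigmin_le. Qed.

Lemma sqdist_ge0 c x : (0 <= sqdist c x)%E.
Proof. by apply: le_bigmin => // j _; rewrite lee_fin sqr_ge0. Qed.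

Lemma sqdist_attained c x : (0 < k)%N -> exists i,
  sqdist c x = (enorm (x - c i) ^+ 2)%:E /\
  forall j, enorm (x - c i) <= enorm (x - c j).
Proof.
move=> k0; have [|i _ iE] := @eq_bigmin _ _ _ +oo%E (Ordinal k0) xpredT
    (fun j => (enorm (x - c j) ^+ 2)%:E) isT.
  by move=> i _; rewrite leey.
exists i; split=> // j; rewrite ler_sqr_enorm ?enorm_ge0// -lee_fin -iE.
exact: sqdist_le.
Qed.

Lemma sqdist_subcode c c' x : (0 < k)%N ->
  (forall i, exists j, c' j = c i) -> (sqdist c' x <= sqdist c x)%E.
Proof.
move=> k0 sub; have [i [-> _]] := sqdist_attained c x k0.
by have [j <-] := sub i; exact: sqdist_le.
Qed.

Lemma measurable_sqdist c :
  measurable_fun [set: planeR R] (sqdist c : planeR R -> \bar R).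
Proof.
rewrite /sqdist; elim: (index_enum _) => [|j s IH].
  apply: (eq_measurable_fun (cst +oo%E)); last exact: measurable_cst.
  by move=> x _; rewrite big_nil.
apply: (eq_measurable_fun (fun x : planeR R =>
    mine ((enorm ((x : R * R) - c j)) ^+ 2)%:E
         (\big[mine/+oo%E]_(i <- s) ((enorm ((x : R * R) - c i)) ^+ 2)%:E))).
  by move=> x _; rewrite big_cons.
apply: measurable_mine => //; apply/measurable_EFinP.
by apply: measurable_funX; exact: measurable_enormB.
Qed.

End sqdist.

(** * Integrals against the mixture, component by component *)

Section mixture_integral.
Variables (R : realType) (k : nat).
Variables (theta : 'I_k -> R) (m : 'I_k -> R * R) (sigma M : R).
Variable P : probability (planeR R) R.
Hypothesis sigma_gt0 : 0 < sigma.
Hypothesis theta_ge0 : forall i, 0 <= theta i.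
Hypothesis P_mixture : is_quasi_gaussian_mixture theta m sigma M P.

Local Notation N := (truncation_mass m sigma M).
Local Notation gauss i := (gauss2 (m i) (sigma ^+ 2)).
Local Notation ball := (eball (0 : R * R) M : set (planeR R)).

(** Left unnormalized: its total mass is [N i], so that [P] combines these integrals with
    coefficients [theta i / N i]. *)
Definition component_integral i (h : R * R -> \bar R) : \bar R :=
  (\int[lebesgue2 R]_(x in ball) (h x * (gauss i x)%:E))%E.

Local Notation W := component_integral.

Let var_gt0 : 0 < sigma ^+ 2. Proof. exact: exprn_gt0. Qed.

Let gauss_ge0 i x : (0 <= (gauss i x)%:E)%E.
Proof. by rewrite lee_fin gauss2_ge0// ltW. Qed.

Let measurable_gauss i (D : set (planeR R)) :
  measurable_fun D (fun x : planeR R => (gauss i x)%:E).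
Proof.
by apply: measurable_funTS; apply/measurable_EFinP; exact: measurable_gauss2.
Qed.

Let mball : measurable ball. Proof. exact: measurable_eball. Qed.

Lemma component_integral1 i : W i (cst 1%E) = (N i)%:E.
Proof.
rewrite /component_integral; under eq_integral do rewrite mul1e.
(* [N i] is a real-valued integral, so finiteness has to be shown; it comes from the total mass [1]
   of the untruncated Gaussian. *)
have -> : N i = fine (\int[lebesgue2 R]_(x in ball) (gauss i x)%:E)%E by [].
rewrite fineK// ge0_fin_numE; last exact: integral_ge0.
apply: (@le_lt_trans _ _ (\int[lebesgue2 R]_x (gauss i x)%:E)%E).
  exact: ge0_subset_integral.
by rewrite integral_gauss2// ltry.
Qed.

Lemma le_component_integral i (h1 h2 : R * R -> \bar R) :
  measurable_fun [set: planeR R] (h1 : planeR R -> \bar R) ->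
  measurable_fun [set: planeR R] (h2 : planeR R -> \bar R) ->
  (forall x, 0 <= h1 x)%E -> (forall x, 0 <= h2 x)%E ->
  (forall x, ball x -> h1 x <= h2 x)%E -> (W i h1 <= W i h2)%E.
Proof.
move=> mh1 mh2 h10 h20 h12; apply: ge0_le_integral => //.
- by move=> x _; exact: mule_ge0.
- by apply: emeasurable_funM => //; exact: measurable_funTS.
- by apply: emeasurable_funM => //; exact: measurable_funTS.
- by move=> x Bx; apply: lee_wpmul2r => //; exact: h12.
Qed.

Lemma component_integralD i (h1 h2 : R * R -> \bar R) :
  measurable_fun [set: planeR R] (h1 : planeR R -> \bar R) ->
  measurable_fun [set: planeR R] (h2 : planeR R -> \bar R) ->
  (forall x, 0 <= h1 x)%E -> (forall x, 0 <= h2 x)%E ->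
  (W i (fun x => h1 x + h2 x) = W i h1 + W i h2)%E.
Proof.
move=> mh1 mh2 h10 h20; rewrite /component_integral.
under eq_integral do rewrite ge0_muleDl//.
rewrite ge0_integralD//.
- by move=> x _; exact: mule_ge0.
- by apply: emeasurable_funM => //; exact: measurable_funTS.
- by move=> x _; exact: mule_ge0.
- by apply: emeasurable_funM => //; exact: measurable_funTS.
Qed.

Lemma component_integralZ i (r : R) (h : R * R -> \bar R) :
  measurable_fun [set: planeR R] (h : planeR R -> \bar R) ->
  (forall x, 0 <= h x)%E -> 0 <= r ->
  (W i (fun x => r%:E * h x) = r%:E * W i h)%E.
Proof.
move=> mh h0 r0; rewrite /component_integral.
under eq_integral do rewrite -muleA.
rewrite ge0_integralZl//.
- by apply: emeasurable_funM => //; exact: measurable_funTS.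
- by move=> x _; exact: mule_ge0.
Qed.

Lemma component_integral_cst i (r : R) : 0 <= r ->
  W i (cst r%:E) = (r * N i)%:E.
Proof.
move=> r0; rewrite EFinM -component_integral1 -component_integralZ//.
by congr (W i _); apply/funext => x; rewrite /= mule1.
Qed.

Lemma component_integral_ge0 i (h : R * R -> \bar R) :
  (forall x, 0 <= h x)%E -> (0 <= W i h)%E.
Proof. by move=> h0; apply: integral_ge0 => x _; exact: mule_ge0. Qed.

Lemma mixture_densityE x :
  mixture_density theta m sigma M x =
  \sum_(i < k) theta i / N i * (gauss i x * \1_ball x).
Proof.
by apply: eq_bigr => i _; rewrite /gauss2 [(_ * N i)^-1]invfM; ring.
Qed.

Hypothesis N_gt0 : forall i, 0 < N i.

Let coef_ge0 i : 0 <= theta i / N i.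
Proof. by rewrite divr_ge0// ltW. Qed.

Lemma mixture_density_ge0 x : 0 <= mixture_density theta m sigma M x.
Proof.
rewrite mixture_densityE; apply: sumr_ge0 => i _.
by rewrite mulr_ge0// mulr_ge0// -lee_fin.
Qed.

Lemma measurable_mixture_density :
  measurable_fun [set: planeR R]
    (mixture_density theta m sigma M : planeR R -> R).
Proof.
rewrite (_ : mixture_density _ _ _ _ = fun x : planeR R =>
  \sum_(i < k) theta i / N i * (gauss i x * \1_ball x)); last first.
  by apply/funext => x; exact: mixture_densityE.
apply: measurable_sum => i; apply: measurable_funM => //.
apply: measurable_funM; first exact: measurable_gauss2.
exact: measurable_indic.
Qed.

Lemma integral_mixture (h : R * R -> \bar R) :
  measurable_fun [set: planeR R] (h : planeR R -> \bar R) ->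
  (forall x, 0 <= h x)%E ->
  (\int[P]_x h x = \sum_(i < k) (theta i / N i)%:E * W i h)%E.
Proof.
move=> mh h0.
pose mu : {sigma_finite_measure set (planeR R) -> \bar R} :=
  HB.pack (lebesgue2 R : set (planeR R) -> \bar R)
    (Measure.class (lebesgue2 R))
    (Measure_isSigmaFinite.Build _ _ _ (lebesgue2 R)
      (sigma_finite_lebesgue2 R)).
rewrite (@ge0_integral_density _ _ _ P mu _ measurable_mixture_density
  mixture_density_ge0 P_mixture _ mh h0).
have mgh i : measurable_fun [set: planeR R]
    (fun x => h x * (gauss i x * \1_ball x)%:E)%E.
  apply: emeasurable_funM => //; apply/measurable_EFinP.
  apply: measurable_funM; first exact: measurable_gauss2.
  exact: measurable_indic.
have gh0 i x : (0 <= h x * (gauss i x * \1_ball x)%:E)%E.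
  by rewrite mule_ge0// lee_fin mulr_ge0// -lee_fin.
transitivity (\int[lebesgue2 R]_x
    (\sum_(i < k) (theta i / N i)%:E * (h x * (gauss i x * \1_ball x)%:E)))%E.
  apply: eq_integral => x _.
  rewrite mixture_densityE -sumEFin ge0_sume_distrr; last first.
    by move=> i _; rewrite lee_fin mulr_ge0// mulr_ge0// -lee_fin.
  by apply: eq_bigr => i _; rewrite EFinM muleCA.
rewrite ge0_integral_sum//; last 2 first.
- by move=> i; apply: measurable_funeM; exact: mgh.
- by move=> i x _; apply: mule_ge0 => //; rewrite lee_fin.
apply: eq_bigr => i _; rewrite ge0_integralZl//; last by rewrite lee_fin.
congr (_ * _)%E.
rewrite /component_integral [RHS]integral_mkcond; apply: eq_integral => x _.
rewrite patchE indicE; case: ifP => xB; first by rewrite mulr1.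
by rewrite mulr0 mule0.
Qed.

Lemma component_integral_le_mixture i (h : R * R -> \bar R) :
  measurable_fun [set: planeR R] (h : planeR R -> \bar R) ->
  (forall x, 0 <= h x)%E ->
  ((theta i / N i)%:E * W i h <= \int[P]_x h x)%E.
Proof.
move=> mh h0; rewrite integral_mixture// (bigD1 i)//=.
apply: leeDl; apply: sume_ge0 => j _; apply: mule_ge0; first by rewrite lee_fin.
exact: component_integral_ge0.
Qed.

(* [1 + u / 5 <= expR (u / 5)] with [u = |x - m i|^2 / (2 sigma^2)] dominates
   the second moment by the mass of a Gaussian with variance [5/4 sigma^2]. *)
Lemma component_second_moment_le i :
  (W i (fun x => (enorm (x - m i) ^+ 2)%:E) <= (5 / 2 * sigma ^+ 2)%:E)%E.
Proof.
have v0 := var_gt0; set v := sigma ^+ 2 in v0 *.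
have m2 : measurable_fun [set: planeR R]
    (fun x : planeR R => (enorm ((x : R * R) - m i) ^+ 2)%:E).
  by apply/measurable_EFinP; apply: measurable_funX; exact: measurable_enormB.
pose S := (\int[lebesgue2 R]_x ((enorm (x - m i) ^+ 2)%:E * (gauss i x)%:E))%E.
have mS : measurable_fun [set: planeR R]
    (fun x : planeR R => (enorm ((x : R * R) - m i) ^+ 2)%:E * (gauss i x)%:E)%E.
  exact: emeasurable_funM.
have S0 x : (0 <= (enorm (x - m i) ^+ 2)%:E * (gauss i x)%:E)%E.
  by rewrite mule_ge0// lee_fin sqr_ge0.
have v'0 : 0 < 5 / 4 * v by rewrite mulr_gt0.
apply: (@le_trans _ _ S); first exact: ge0_subset_integral.
(* The ratio [5 / 4] of the variances turns the factor [10 * v] into [25 / 2 * v]; both Gaussians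
   have mass [1], and subtracting [10 * v] leaves [5 / 2 * v]. *)
have : (S + (10 * v)%:E * \int[lebesgue2 R]_x (gauss i x)%:E <=
    (25 / 2 * v)%:E * \int[lebesgue2 R]_x (gauss2 (m i) (5 / 4 * v) x)%:E)%E.
  have mg' : measurable_fun [set: planeR R]
      (fun x : planeR R => (gauss2 (m i) (5 / 4 * v) x)%:E).
    by apply/measurable_EFinP; exact: measurable_gauss2.
  rewrite -ge0_integralZl//; last by rewrite lee_fin mulr_ge0// ltW.
  rewrite -[leRHS]ge0_integralZl//; last 2 first.
  - by move=> x _; rewrite lee_fin gauss2_ge0// ltW.
  - by rewrite lee_fin mulr_ge0// ltW.
  have g0 x : (0 <= (10 * v)%:E * (gauss i x)%:E)%E.
    by rewrite mule_ge0// lee_fin mulr_ge0// ltW.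
  have mg : measurable_fun [set: planeR R]
      (fun x : planeR R => (10 * v)%:E * (gauss i x)%:E)%E.
    exact: emeasurable_funM.
  rewrite -ge0_integralD//; apply: ge0_le_integral => //.
  - by move=> x _; rewrite adde_ge0.
  - exact: emeasurable_funD.
  - exact: emeasurable_funM.
  - move=> x _; rewrite -!EFinM -EFinD lee_fin /gauss2 -/v.
    set u := enorm _ ^+ 2.
    have -> : expR (- (u / (2 * (5 / 4 * v)))) =
        expR (- (u / (2 * v))) * expR (u / (10 * v)).
      by rewrite -expRD; congr expR; field; exact: lt0r_neq0.
    set g := expR (- _); set E := expR _.
    have uE : u + 10 * v <= 10 * v * E.
      have := expR_ge1Dx (u / (10 * v)); rewrite -/E => uE.
      have v10 : 0 < 10 * v by rewrite mulr_gt0.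
      apply: le_trans (ler_wpM2l (ltW v10) uE).
      by rewrite mulrDr mulr1 addrC [10 * v * (u / _)]mulrC divfK ?gt_eqF.
    have -> : 25 / 2 * v * ((2 * pi * (5 / 4 * v))^-1 * (g * E)) =
        10 * v * E * ((2 * pi * v)^-1 * g).
      have := pi_gt0 R; move: pi => p p0.
      by field; rewrite (gt_eqF v0) (gt_eqF p0).
    rewrite -mulrDl; apply: ler_wpM2r => //.
    by rewrite mulr_ge0 ?expR_ge0// invr_ge0 !mulr_ge0 ?pi_ge0// ltW.
rewrite !integral_gauss2// !mule1.
case: S => [s| |]; [|by rewrite addye// leye_eq|by move=> _; exact: leNye].
by rewrite -EFinD !lee_fin; lra.
Qed.

End mixture_integral.

(** * Extended quotients, separation of the means and extreme weights *)

Section thresholds.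
Variable R : realType.

(** Since [a / 0 = +oo], a real bound on the quotient excludes a zero denominator; this is what
    yields [eps < 1] and a positive separation of the means. *)
Lemma lee_div_fin (a b q : R) : 0 < a -> 0 <= b ->
  (a%:E / b%:E <= q%:E)%E -> 0 < b /\ a <= q * b.
Proof.
move=> a0 b0; rewrite inver; case: eqVneq => [->|b_neq0].
  by rewrite gt0_muley ?lte_fin// leye_eq.
have b_gt0 : 0 < b by rewrite lt_neqAle eq_sym b_neq0.
by rewrite -EFinM lee_fin ler_pdivrMr.
Qed.

Variables (k : nat) (theta : 'I_k -> R) (m : 'I_k -> R * R).

Lemma mean_sep_le i j : i != j -> mean_sep m <= enorm (m i - m j).
Proof.
move=> ij; apply: ge_inf; last by exists i, j.
by exists 0 => _ [? [? [_ ->]]]; exact: enorm_ge0.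
Qed.

Lemma mean_sep_ge0 : 0 <= mean_sep m.
Proof.
have [E0|E0] := eqVneq [set b | exists i j, i != j /\ b = enorm (m i - m j)] set0.
  by rewrite /mean_sep E0 inf0.
by apply: lb_le_inf; [exact/set0P|move=> _ [? [? [_ ->]]]; exact: enorm_ge0].
Qed.

Lemma mean_sep_gt0_card : 0 < mean_sep m -> (1 < k)%N.
Proof.
rewrite ltNge => ms; rewrite ltnNge; apply: contra ms => k1.
rewrite /mean_sep (_ : [set b | _] = set0) ?inf0//.
apply/seteqP; split=> // b [i [j [/eqP ij _]]]; apply: ij; apply: val_inj => /=.
have := leq_trans (ltn_ord i) k1; have := leq_trans (ltn_ord j) k1.
by rewrite !ltnS !leqn0 => /eqP -> /eqP ->.
Qed.

Hypotheses (theta_ge0 : forall i, 0 <= theta i).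

Lemma theta_min_le i : theta_min theta <= theta i.
Proof. by apply: ge_inf; [exists 0 => _ [j _ <-]|exists i]. Qed.

Lemma theta_max_ge i : theta i <= theta_max theta.
Proof.
apply: ub_le_sup; last by exists i.
exists (\sum_(j < k) theta j) => _ [j _ <-].
by rewrite (bigD1 j)//= lerDl sumr_ge0.
Qed.

End thresholds.

(** * Separated mixtures: optimal codebooks are close to the means *)

Section separated_mixture.
Variables (R : realType) (k : nat).
Variables (theta : 'I_k -> R) (m : 'I_k -> R * R) (sigma M eps : R).
Variable P : probability (planeR R) R.
Variables (B tmin tmax : R).
Hypotheses (sigma_gt0 : 0 < sigma) (M_gt0 : 0 < M) (B_gt0 : 0 < B).
Hypotheses (k_gt1 : (1 < k)%N) (eps_ge0 : 0 <= eps) (eps_lt1 : eps < 1).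
Hypotheses (tmin_gt0 : 0 < tmin) (tmin_le : forall i, tmin <= theta i).
Hypothesis tmax_ge : forall i, theta i <= tmax.
Hypothesis theta_sum1 : \sum_(i < k) theta i = 1.
Hypothesis P_mixture : is_quasi_gaussian_mixture theta m sigma M P.
Hypothesis N_ge : forall i, 1 - eps <= truncation_mass m sigma M i.
Hypothesis mean_sep_ge : forall i j, i != j -> B <= enorm (m i - m j).
Hypothesis ball_sub : forall i, eball (m i) (B / 3) `<=` eball (0 : R * R) M.
Hypothesis noise_small :
  2048 * k%:R * sigma ^+ 2 * tmax <= tmin * ((1 - eps) * B ^+ 2).
Hypothesis overlap_small : 2048 * k%:R ^+ 2 * M ^+ 3 * tmax <=
  tmin * ((1 - eps) * 7 * sigma ^+ 2 * B * expR (B ^+ 2 / (32 * sigma ^+ 2))).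

Local Notation N := (truncation_mass m sigma M).
Local Notation v := (sigma ^+ 2).
Local Notation W := (component_integral m sigma M).
Local Notation ball := (eball (0 : R * R) M : set (planeR R)).
Local Notation dist i := (fun x : R * R => (enorm (x - m i) ^+ 2)%:E).

Let v_gt0 : 0 < v. Proof. exact: exprn_gt0. Qed.

Let k_gt0 : (0 < k)%N. Proof. exact: ltnW. Qed.

Let theta_gt0 i : 0 < theta i. Proof. exact: lt_le_trans (tmin_le i). Qed.

Let theta_ge0 i : 0 <= theta i. Proof. exact: ltW. Qed.

Let eps1_gt0 : 0 < 1 - eps. Proof. by rewrite subr_gt0. Qed.

Let N_gt0 i : 0 < N i. Proof. exact: lt_le_trans (N_ge i). Qed.

Let tmin_le_tmax : tmin <= tmax.
Proof. exact: le_trans (tmin_le (Ordinal k_gt0)) (tmax_ge _). Qed.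

Let k_ge2 : 2 <= k%:R :> R. Proof. by rewrite ler_nat. Qed.

Let ktmax_ge1 : 1 <= k%:R * tmax.
Proof.
rewrite -[leLHS]theta_sum1 (le_trans (ler_sum _ (fun i _ => tmax_ge i)))//.
by rewrite sumr_const card_ord mulr_natl.
Qed.

Let coef_le i : theta i / N i <= theta i / (1 - eps).
Proof. by apply: ler_wpM2l => //; rewrite lef_pV2// posrE. Qed.

Let measurable_dist i :
  measurable_fun [set: planeR R] (dist i : planeR R -> \bar R).
Proof.
by apply/measurable_EFinP; apply: measurable_funX; exact: measurable_enormB.
Qed.

Let dist_ge0 i x : (0 <= dist i x)%E. Proof. by rewrite lee_fin sqr_ge0. Qed.

Let second_moment i : exists2 s, W i (dist i) = s%:E & 0 <= s <= 5 / 2 * v.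
Proof.
have := component_integral_ge0 m M sigma_gt0 i (dist_ge0 i).
have := component_second_moment_le m M sigma_gt0 i.
case: (W i _) => [s| |]//; rewrite !lee_fin => s1 s0.
by exists s => //; rewrite s0.
Qed.

Let ler_second_moment i s : 0 <= s <= 5 / 2 * v ->
  theta i / N i * s <= theta i * (5 / 2 * v / (1 - eps)).
Proof.
move=> /andP[s0 s1].
have -> : theta i * (5 / 2 * v / (1 - eps)) = theta i / (1 - eps) * (5 / 2 * v).
  by ring.
by apply: ler_pM; rewrite // divr_ge0// ltW.
Qed.

Let noise_le i :
  2048 * (v * (k%:R * tmax)) <= theta i * ((1 - eps) * B ^+ 2).
Proof.
rewrite (_ : 2048 * _ = 2048 * k%:R * v * tmax); last by ring.
apply: le_trans noise_small _; apply: ler_wpM2r => //.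
by rewrite mulr_ge0 ?sqr_ge0// ltW.
Qed.

Let variance_le : v / (1 - eps) <= B ^+ 2 / 4096.
Proof.
have i := Ordinal k_gt0.
apply: (variance_ratio_le v_gt0 (theta_gt0 i) _ eps1_gt0 (noise_le i)).
by apply: ler_pM => //; exact: ltW.
Qed.

(** Comparison with the codebook [m]: integrating the [i]-th component against the distance to its
    own mean leaves only its second moment, and [1 - eps <= N i] costs the denominator. *)
Lemma optimal_risk_le (c : 'I_k -> R * R) : optimal P c ->
  (\int[P]_x sqdist c x <= (5 / 2 * v / (1 - eps))%:E)%E.
Proof.
move=> /(_ m) /le_trans; apply.
rewrite /risk -/(sqdist m) (integral_mixture sigma_gt0 theta_ge0 P_mixture)//;
  last 2 first.
- exact: measurable_sqdist.
- exact: sqdist_ge0.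
rewrite -[leRHS]mul1e -[X in (X%:E * _)%E]theta_sum1 -sumEFin ge0_sume_distrl; last first.
  by move=> i _; rewrite lee_fin.
apply: lee_sum => i _; have [s sE s_itv] := second_moment i.
rewrite (le_trans (y := (theta i / N i)%:E * W i (dist i)))%E//; last first.
  by rewrite sE -!EFinM lee_fin ler_second_moment.
apply: lee_wpmul2l; first by rewrite lee_fin divr_ge0// ltW.
apply: le_component_integral => //.
- exact: measurable_sqdist.
- exact: sqdist_ge0.
- by move=> x _; exact: sqdist_le.
Qed.

(* If no code point is near [m i], then [|x - c j|^2 + |x - m i|^2 >=
   (B / 16)^2 / 2] for all [x] and [j], so that the mass of the [i]-th
   component alone makes the risk too large. *)
Lemma optimal_near_mean (c : 'I_k -> R * R) i : optimal P c ->
  exists j, enorm (c j - m i) <= B / 16.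
Proof.
move=> copt; apply: contrapT => /forallNP far.
have risk_le := optimal_risk_le copt.
have [s sE s_itv] := second_moment i.
have r0 : 0 <= B ^+ 2 / 512 := divr_ge0 (sqr_ge0 B) (ler0n _ _).
have lbE : (W i (cst (B ^+ 2 / 512)%:E) <= W i (sqdist c) + s%:E)%E.
  rewrite -sE -component_integralD//; last 2 first.
  - exact: measurable_sqdist.
  - exact: sqdist_ge0.
  apply: le_component_integral => //.
  - by apply: emeasurable_funD => //; exact: measurable_sqdist.
  - by move=> x; rewrite adde_ge0// sqdist_ge0.
  move=> x _; have [j [-> _]] := sqdist_attained c x k_gt0.
  rewrite -EFinD lee_fin /=.
  have /negP := far j; rewrite -ltNge => farj.
  apply: (far_sqr_sum B_gt0 farj); rewrite (enorm_distC x (c j)).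
  exact: ler_enorm_distD.
have := component_integral_le_mixture sigma_gt0 theta_ge0 P_mixture N_gt0 i
  (measurable_sqdist c) (sqdist_ge0 c).
move=> /le_trans /(_ risk_le).
move: lbE (component_integral_ge0 m M sigma_gt0 i (sqdist_ge0 c)).
rewrite component_integral_cst//; have cN : 0 < theta i / N i by rewrite divr_gt0.
case: (W i _) => [q| |]//; last first.
  by move=> _ _; rewrite gt0_muley// ?lte_fin// leye_eq.
rewrite -EFinD -EFinM !lee_fin => lbE q0 ubE.
have := ler_wpM2l (ltW cN) lbE; rewrite mulrDr => lb.
have := ler_second_moment i s_itv.
have e1 : theta i / N i * (B ^+ 2 / 512 * N i) = theta i * (B ^+ 2 / 512).
  by rewrite mulrCA divfK ?gt_eqF// mulrC.
rewrite e1 in lb.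
move=> sm.
have key : theta i * (B ^+ 2 / 512) <= 5 / 2 * v / (1 - eps) * (1 + theta i).
  by lra.
apply: (heavy_component_absurd v_gt0 (theta_gt0 i) _ ktmax_ge1 eps1_gt0 _ key).
  by apply: ler_pM => //; exact: ltW.
exact: noise_le.
Qed.

(** Chebyshev's inequality for the [i]-th component alone. Its mass [N i] cancels the normalization
    in [theta i / N i], so truncation affects only the second-moment term. *)
Lemma mean_ball_mass_ge i :
  ((99 / 100 * theta i)%:E <= P (eball (m i) (B / 4)))%E.
Proof.
pose A : set (planeR R) := eball (m i) (B / 4).
have mA : measurable A by exact: measurable_eball.
have [s sE s_itv] := second_moment i.
pose h (x : R * R) : \bar R := (\1_A x)%:E.
have mh : measurable_fun [set: planeR R] (h : planeR R -> \bar R).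
  by apply/measurable_EFinP; exact: measurable_indic.
have h0 x : (0 <= h x)%E by rewrite lee_fin.
have r0 : 0 <= B ^+ 2 / 16 := divr_ge0 (sqr_ge0 B) (ler0n _ _).
have lbE : (W i (cst (B ^+ 2 / 16)%:E) <= (B ^+ 2 / 16)%:E * W i h + s%:E)%E.
  rewrite -sE -component_integralZ// -component_integralD//; last 2 first.
  - exact: measurable_funeM.
  - by move=> x; apply: mule_ge0 => //; rewrite lee_fin.
  apply: le_component_integral => //.
  - by apply: emeasurable_funD => //; exact: measurable_funeM.
  - move=> x; apply: adde_ge0 => //; apply: mule_ge0 => //.
  move=> x _; rewrite /h -EFinM -EFinD lee_fin /= indicE.
  have [xA|] := boolP (x \in A); first by rewrite mulr1 lerDl sqr_ge0.
  rewrite notin_setE /A/= => /negP; rewrite -ltNge => xr.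
  rewrite mulr0 add0r -[B ^+ 2 / 16](_ : (B / 4) ^+ 2 = _); last by field.
  rewrite ler_pXn2r ?nnegrE ?enorm_ge0 ?(ltW xr)//.
  by rewrite divr_ge0// ltW.
have PA : (P A = \int[P]_x h x)%E by rewrite integral_indic// setIT.
have := component_integral_le_mixture sigma_gt0 theta_ge0 P_mixture N_gt0 i
  mh h0.
rewrite -PA => /(le_trans _); apply.
move: lbE (component_integral_ge0 m M sigma_gt0 i h0).
rewrite component_integral_cst//; have cN : 0 < theta i / N i by rewrite divr_gt0.
case: (W i _) => [q| |]//; last by move=> _ _; rewrite gt0_muley ?leey ?lte_fin.
rewrite -EFinM -EFinD -EFinM !lee_fin => lbE q0.
have := ler_wpM2l (ltW cN) lbE; rewrite mulrDr => lb.
have := ler_second_moment i s_itv.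
have e1 : theta i / N i * (B ^+ 2 / 16 * N i) = theta i * (B ^+ 2 / 16).
  by rewrite mulrCA divfK ?gt_eqF// mulrC.
rewrite e1 in lb.
move=> sm.
apply: chebyshev_arith (theta_ge0 i) _ variance_le sm lb; exact: exprn_gt0.
Qed.

(** * Density away from the means and mass near bisectors *)

Let E := expR (- (B ^+ 2 / (32 * v))).

Let E_gt0 : 0 < E. Proof. exact: expR_gt0. Qed.

(** [E] is the Gaussian factor at distance [B / 4] from a mean, and [E ^+ 4] the one at distance
    [B / 2]. The bound gives [E ^+ 4 <= tmax / 4 * E]: all components but the nearest one add at
    most a quarter of the leading term. *)
Let E_le : E <= tmax / 64.
Proof.
apply: (exp_overlap_le v_gt0 tmin_gt0 tmin_le_tmax ktmax_ge1 _ eps1_gt0).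
- by rewrite ltr0n.
- by rewrite lerBlDr lerDl.
- by rewrite (_ : 2048 * _ = 2048 * k%:R * v * tmax)//; ring.
Qed.

Let gauss_far_le r d : 0 <= r -> r <= d ->
  expR (- (d ^+ 2 / (2 * v))) <= expR (- (r ^+ 2 / (2 * v))).
Proof.
move=> r0 rd; rewrite ler_expR lerN2 ler_pM2r ?invr_gt0 ?mulr_gt0//.
by rewrite ler_pXn2r ?nnegrE// (le_trans r0).
Qed.

(* At most one mean is closer to [x] than [B / 2], so that a single component
   contributes at the scale [E]; the others contribute at the scale [E ^+ 4]. *)
Let sum_far_le (x : R * R) : (forall l, B / 4 <= enorm (x - m l)) ->
  \sum_(i < k) theta i * expR (- (enorm (x - m i) ^+ 2 / (2 * v))) <=
  5 / 4 * tmax * E.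
Proof.
move=> far; have B0 := ltW B_gt0.
have tmax0 : 0 < tmax := lt_le_trans tmin_gt0 tmin_le_tmax.
have E1 i : expR (- (enorm (x - m i) ^+ 2 / (2 * v))) <= E.
  rewrite /E (_ : B ^+ 2 / (32 * v) = (B / 4) ^+ 2 / (2 * v)).
    by apply: gauss_far_le (far i); rewrite divr_ge0.
  by field; exact: lt0r_neq0.
have E4 i : B / 2 <= enorm (x - m i) ->
    expR (- (enorm (x - m i) ^+ 2 / (2 * v))) <= E ^+ 4.
  move=> farther; rewrite /E -expRM_natl.
  rewrite (_ : 4%:R * - (B ^+ 2 / (32 * v)) = - ((B / 2) ^+ 2 / (2 * v))).
    by apply: gauss_far_le farther; rewrite divr_ge0.
  by field; exact: lt0r_neq0.
have E_le1 : E <= 1 by rewrite -expR0 ler_expR oppr_le0 divr_ge0 ?sqr_ge0//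
  mulr_ge0 ?ltW.
have E4_le : E ^+ 4 <= tmax / 4 * E.
  rewrite exprSr; apply: ler_wpM2r; first exact: ltW.
  apply: (@le_trans _ _ E); last by move: E_le; lra.
  by rewrite -[leRHS]expr1 ler_wiXn2l// ltW.
suff : \sum_(i < k) theta i * expR (- (enorm (x - m i) ^+ 2 / (2 * v))) <=
    tmax * E + E ^+ 4 by lra.
have [[i0 near0]|nnear] := pselect (exists i, enorm (x - m i) < B / 2).
  rewrite (bigD1 i0)//=; apply: lerD.
    by apply: ler_pM => //; exact: expR_ge0.
  apply: (@le_trans _ _ ((\sum_(i < k | i != i0) theta i) * E ^+ 4)).
    rewrite mulr_suml; apply: ler_sum => j ji0; apply: ler_wpM2l => //.
    apply: E4; have := mean_sep_ge ji0; have := ler_enorm_distD x (m j) (m i0).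
    by rewrite (enorm_distC (m j) x); lra.
  apply: ler_piMl; first by rewrite exprn_ge0// ltW.
  by rewrite -[leRHS]theta_sum1 [leRHS](bigD1 i0)//= lerDr.
apply: (@le_trans _ _ (1 * E ^+ 4)); last first.
  by rewrite mul1r lerDr mulr_ge0 ?ltW.
rewrite -[X in _ <= X * _]theta_sum1 mulr_suml.
apply: ler_sum => j _; apply: ler_wpM2l => //; apply: E4.
by rewrite leNgt; apply/negP => near; apply: nnear; exists j.
Qed.

Let density_bound := 5 / 4 * tmax * E / (2 * pi * v * (1 - eps)).

Lemma mixture_density_far_le (x : R * R) :
  (forall l, B / 4 <= enorm (x - m l)) ->
  mixture_density theta m sigma M x <= density_bound.
Proof.
move=> far; have pv : 0 < 2 * pi * v by rewrite !mulr_gt0// pi_gt0.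
rewrite mixture_densityE /density_bound invfM mulrA.
rewrite ler_pdivlMr// mulr_suml -ler_pdivrMr ?invr_gt0// invrK mulr_suml.
apply: le_trans (sum_far_le far); apply: ler_sum => i _.
rewrite /gauss2.
set g := expR _.
have -> : theta i / N i * ((2 * pi * v)^-1 * g * \1_(eball 0 M) x) *
    (1 - eps) * (2 * pi * v) =
    theta i * g * (\1_(eball 0 M) x * ((1 - eps) / N i)).
  rewrite -[RHS]mulr1 -[X in _ = _ * X](mulVf (lt0r_neq0 pv)).
  by move: (2 * pi * v) => p; ring.
rewrite ler_piMr ?mulr_ge0 ?expR_ge0//.
apply: mulr_ile1 => //; first by rewrite divr_ge0// ltW.
by rewrite ler_pdivrMr// mul1r.
Qed.

Definition bisector_zone (c : 'I_k -> R * R) (w : R) : set (R * R) :=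
  [set x | [/\ enorm x <= M, forall l, B / 4 <= enorm (x - m l) &
    exists i j, i != j /\
    `|enorm (x - c i) ^+ 2 - enorm (x - c j) ^+ 2| <=
      2 * w * enorm (c i - c j)]].

Let strip (c : 'I_k -> R * R) w (p : 'I_k * 'I_k) : set (planeR R) :=
  if p.1 == p.2 then set0 else
  box_strip (c p.1 - c p.2)
    ((enorm (c p.1) ^+ 2 - enorm (c p.2) ^+ 2) / 2) w M.

Let stripE c w i j x : i != j -> enorm x <= M -> strip c w (i, j) x <->
  `|enorm (x - c i) ^+ 2 - enorm (x - c j) ^+ 2| <= 2 * w * enorm (c i - c j).
Proof.
move=> ij xM; rewrite /strip (negbTE ij) /box_strip/=.
have -> : enorm (x - c i) ^+ 2 - enorm (x - c j) ^+ 2 = - (2 *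
  (((c i).1 - (c j).1) * x.1 + ((c i).2 - (c j).2) * x.2 -
   (enorm (c i) ^+ 2 - enorm (c j) ^+ 2) / 2)).
  by rewrite !sqr_enormB !sqr_enorm; field.
rewrite normrN normrM ger0_norm// -mulrA ler_pM2l//.
split=> [[]//|->]; split=> //; apply: le_trans xM.
- rewrite -(@ler_pXn2r _ 2)// ?nnegrE ?enorm_ge0// real_normK ?num_real//.
  by rewrite sqr_enorm lerDl sqr_ge0.
- rewrite -(@ler_pXn2r _ 2)// ?nnegrE ?enorm_ge0// real_normK ?num_real//.
  by rewrite sqr_enorm lerDr sqr_ge0.
Qed.

Let measurable_strip c w p : measurable (strip c w p).
Proof.
by rewrite /strip; case: ifP => _ //; exact: measurable_box_strip.
Qed.

Let far_set : set (planeR R) :=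
  \bigcap_(l in setT) ~` [set x : planeR R | enorm ((x : R * R) - m l) < B / 4].

Let measurable_far_set : measurable far_set.
Proof.
apply: fin_bigcap_measurable => // l _; apply: measurableC.
rewrite (_ : [set x | _] = setT `&`
    (fun x : planeR R => enorm ((x : R * R) - m l)) @^-1` `]-oo, B / 4[%classic).
  exact: measurable_enormB.
by rewrite setTI; apply/seteqP; split=> x /=; rewrite in_itv.
Qed.

Let bisector_zoneE c w : bisector_zone c w =
  (far_set `&` eball (0 : R * R) M) `&` \big[setU/set0]_p strip c w p.
Proof.
rewrite -bigcup_seq; apply/seteqP; split=> x.
  move=> [xM far [i [j [ij x_ij]]]]; split; first split.
  - by move=> l _ /=; apply/negP; rewrite -leNgt.
  - by rewrite /eball/= subr0.
  - by exists (i, j); rewrite /= ?mem_index_enum//; apply/stripE.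
move=> [[far]]; rewrite /eball/= subr0 => xM [[i j] _].
have [->|ij] := eqVneq i j; first by rewrite /strip eqxx.
move=> /(stripE _ _ ij xM) x_ij; split=> //; last by exists i, j.
by move=> l; rewrite leNgt; apply/negP; exact: far.
Qed.

Lemma measurable_bisector_zone c w :
  measurable (bisector_zone c w : set (planeR R)).
Proof.
rewrite bisector_zoneE; apply: measurableI; last exact: bigsetU_measurable.
by apply: measurableI => //; exact: measurable_eball.
Qed.

Let bound_le w : 0 <= w ->
  density_bound * (k%:R ^+ 2 * (6 * M * w)) <= tmin * B / (150 * M ^+ 2) * w.
Proof.
move=> w0; apply: overlap_mass_le => //.
- exact: ltW.
- exact: ltW.
- exact: pi_ge2.
- by rewrite /E expRN invrK.
Qed.

(** The density bound times the total area of at most [k ^ 2] strips. Code points must be distinct,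
    since two equal ones are equidistant from the whole plane. *)
Lemma bisector_zone_mass_le (c : 'I_k -> R * R) w : 0 <= w ->
  (forall i j, i != j -> 0 < enorm (c i - c j)) ->
  (P (bisector_zone c w) <= (tmin * B / (150 * M ^+ 2) * w)%:E)%E.
Proof.
move=> w0 c_sep; have mZ := measurable_bisector_zone c w.
have tmax0 : 0 < tmax := lt_le_trans tmin_gt0 tmin_le_tmax.
have db0 : 0 <= density_bound.
  by rewrite divr_ge0 ?mulr_ge0 ?pi_ge0// ltW.
rewrite P_mixture//.
apply: (@le_trans _ _ (\int[lebesgue2 R]_(x in bisector_zone c w)
    (cst density_bound%:E x))%E).
  apply: ge0_le_integral => //.
  - move=> x _; rewrite lee_fin; exact: mixture_density_ge0.
  - apply: measurable_funTS; apply/measurable_EFinP.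
    exact: measurable_mixture_density.
  - by move=> x [_ far _]; rewrite lee_fin mixture_density_far_le.
rewrite integral_cst//.
apply: (@le_trans _ _ (density_bound%:E * (k%:R ^+ 2 * (6 * M * w))%:E)%E);
  last by rewrite -EFinM lee_fin bound_le.
apply: lee_wpmul2l; first by rewrite lee_fin.
have mU : measurable (\big[setU/set0]_p strip c w p).
  exact: bigsetU_measurable.
apply: (@le_trans _ _ (lebesgue2 R (\big[setU/set0]_p strip c w p))).
  by apply: le_measure; rewrite ?inE// bisector_zoneE; exact: subIsetr.
apply: (le_trans (measure_bigsetU_le _ _ (measurable_strip c w))).
apply: (@le_trans _ _ (\sum_(p : 'I_k * 'I_k) (6 * M * w)%:E)%E).
  apply: lee_sum => -[i j] _; rewrite /strip/=; case: eqVneq => [_|ij].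
    by rewrite measure0 lee_fin !mulr_ge0// ltW.
  by apply: lebesgue2_box_strip_le => //; [exact: c_sep|exact: ltW].
rewrite sumEFin sumr_const card_prod !card_ord lee_fin.
by rewrite -[leLHS]mulr_natl natrM expr2.
Qed.

(** Besides closeness, this fixes the labelling, so that two codebooks can be averaged index by
    index. *)
Definition near_means (c : 'I_k -> R * R) : Prop :=
  forall i, enorm (c i - m i) <= B / 16.

Lemma near_means_sep c : near_means c ->
  forall i j, i != j -> 7 / 8 * B <= enorm (c i - c j).
Proof.
move=> cm i j ij; have := mean_sep_ge ij; have := cm i; have := cm j.
have := ler_enorm_distD (c i) (m i) (m j).
have := ler_enorm_distD (c j) (c i) (m j).
by rewrite (enorm_distC (m i) (c i)); lra.
Qed.

Lemma near_means_ball c : near_means c -> forall i, enorm (c i) <= M.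
Proof.
move=> cm i; have := @ball_sub i (c i); rewrite /eball/= subr0; apply.
by have := cm i; have := B_gt0; lra.
Qed.

(** The distances are at most [5 / 16 * B] and at least [11 / 16 * B]. *)
Lemma near_means_cell c : near_means c -> forall i x,
  enorm (x - m i) <= B / 4 -> forall j, j != i -> enorm (x - c i) < enorm (x - c j).
Proof.
move=> cm i x xi j ji; have := mean_sep_ge ji; have := cm i; have := cm j.
have := ler_enorm_distD (m i) x (c i).
have := ler_enorm_distD (c j) (m j) (m i).
have := ler_enorm_distD x (c j) (m i).
rewrite (enorm_distC (m i) (c i)) (enorm_distC (c j) x) (enorm_distC (m j) (c j)).
by have := B_gt0; lra.
Qed.

Let mass_outside_ball : P (~` (eball (0 : R * R) M : set (planeR R))) = 0%E.
Proof.
rewrite P_mixture; last by apply: measurableC; exact: measurable_eball.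
apply: integral0_eq => x /= xB; rewrite mixture_densityE big1// => i _.
by rewrite indicE memNset// !mulr0.
Qed.

(** * Strict convexity of the risk near the means, and uniqueness *)

Section strict_convexity.
Variables (c c' : 'I_k -> R * R) (d : R).
Hypotheses (cm : near_means c) (cm' : near_means c').
Hypothesis cc'_le : forall i, enorm (c i - c' i) <= d.

Let mid i := 2^-1 *: (c i + c' i).

(** Chosen so that [2 * w * (7 / 8 * B) = 8 * M * d]. Replacing [c] by [c'] changes each squared
    distance by at most [4 * M * d], so if the nearest indices [i] for [c] and [j] for [c'] differ,
    the squared distances to [c i] and [c j] differ by at most [8 * M * d]. *)
Let w := 32 * M * d / (7 * B).

Let d_ge0 : 0 <= d.
Proof. exact: le_trans (enorm_ge0 _) (cc'_le (Ordinal k_gt0)). Qed.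

Let w_ge0 : 0 <= w.
Proof. by rewrite divr_ge0 ?mulr_ge0// ltW. Qed.

(* Where the nearest code points of [c] and [c'] have the same index, the
   parallelogram identity gives the gain on the left.  Elsewhere, [x] is far
   from all means and close to a bisector of [c]. *)
Let sqdist_mid_le i0 (x : R * R) : enorm x <= M ->
  (sqdist mid x +
     (4^-1 * enorm (c i0 - c' i0) ^+ 2 * \1_(eball (m i0) (B / 4)) x)%:E <=
   (2^-1)%:E * sqdist c x + (2^-1)%:E * sqdist c' x +
     (2 * M * d * \1_(bisector_zone c w) x)%:E)%E.
Proof.
move=> xM.
have [i [-> ci]] := sqdist_attained c x k_gt0.
have [j [-> cj]] := sqdist_attained c' x k_gt0.
have in_cell l : x \in eball (m l) (B / 4) -> i = l /\ j = l.
  rewrite inE => xl; split; apply/eqP.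
    apply: contraT => /(near_means_cell cm xl); rewrite ltNge.
    by rewrite (ci l).
  apply: contraT => /(near_means_cell cm' xl); rewrite ltNge.
  by rewrite (cj l).
have Z0 : 0 <= 2 * M * d * \1_(bisector_zone c w) x.
  by rewrite !mulr_ge0// ltW.
rewrite -!EFinM -!EFinD.
have [ij|ij] := eqVneq i j.
  apply: le_trans (leeD2r _ (sqdist_le mid x i)) _.
  rewrite -EFinD lee_fin midpoint_sqr_enorm -ij.
  suff : 4^-1 * enorm (c i0 - c' i0) ^+ 2 * \1_(eball (m i0) (B / 4)) x <=
      4^-1 * enorm (c i - c' i) ^+ 2 by lra.
  rewrite indicE; have [/in_cell[-> _]|_] := boolP (_ \in _).
    by rewrite mulr1.
  by rewrite mulr0 mulr_ge0 ?invr_ge0 ?sqr_ge0.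
have notin_cell l : x \notin eball (m l) (B / 4).
  by apply: contra ij => /in_cell[-> ->].
have g_le := sqr_enorm_sub_le xM (near_means_ball cm' i)
  (near_means_ball cm i) _.
have h_le := sqr_enorm_sub_le xM (near_means_ball cm j)
  (near_means_ball cm' j) (cc'_le j).
have {}g_le := g_le d; rewrite enorm_distC in g_le.
have {}g_le := g_le (cc'_le i).
have ci_j : enorm (x - c i) ^+ 2 <= enorm (x - c j) ^+ 2.
  by rewrite -ler_sqr_enorm ?enorm_ge0.
have cj_i : enorm (x - c' j) ^+ 2 <= enorm (x - c' i) ^+ 2.
  by rewrite -ler_sqr_enorm ?enorm_ge0.
have xZ : x \in bisector_zone c w.
  rewrite inE; split=> //.
    move=> l; have := notin_cell l; rewrite notin_setE /eball/= => /negP.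
    by rewrite -ltNge => /ltW.
  exists i, j; split=> //; rewrite ler0_norm; last by lra.
  have sep := near_means_sep cm ij.
  have : 2 * w * (7 / 8 * B) <= 2 * w * enorm (c i - c j).
    by apply: ler_wpM2l => //; rewrite mulr_ge0.
  have -> : 2 * w * (7 / 8 * B) = 8 * M * d.
    by rewrite /w; field; exact: lt0r_neq0.
  by lra.
rewrite !indicE xZ (negbTE (notin_cell i0)) mulr0 mulr1 adde0.
(* Averaging the bounds given by the indices [i] and [j] leaves an excess of one quarter of
   [8 * M * d], that is [2 * M * d]. *)
have le_avg (p q : R) : (sqdist mid x <= p%:E)%E -> (sqdist mid x <= q%:E)%E ->
    (sqdist mid x <= (2^-1 * p + 2^-1 * q)%:E)%E.
  case: (sqdist mid x) => [z| |]; [|by []|by move=> _ _; exact: leNye].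
  by rewrite !lee_fin; lra.
apply: (le_trans (le_avg _ _ (sqdist_le mid x i) (sqdist_le mid x j))).
rewrite lee_fin (midpoint_sqr_enorm x (c i)) (midpoint_sqr_enorm x (c j)).
have := sqr_ge0 (enorm (c i - c' i)); have := sqr_ge0 (enorm (c j - c' j)).
by lra.
Qed.

Lemma risk_mid_le i0 :
  (\int[P]_x sqdist mid x +
     (4^-1 * enorm (c i0 - c' i0) ^+ 2 * (99 / 100 * tmin))%:E <=
   (2^-1)%:E * \int[P]_x sqdist c x + (2^-1)%:E * \int[P]_x sqdist c' x +
     (2 * M * d * (tmin * B / (150 * M ^+ 2) * w))%:E)%E.
Proof.
pose A : set (planeR R) := eball (m i0) (B / 4).
pose Z : set (planeR R) := bisector_zone c w.
have mA : measurable A by exact: measurable_eball.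
have mZ : measurable Z by exact: measurable_bisector_zone.
have half0 : (0 <= (2^-1)%:E :> \bar R)%E by rewrite lee_fin invr_ge0.
have a0 : 0 <= 4^-1 * enorm (c i0 - c' i0) ^+ 2.
  by rewrite mulr_ge0 ?invr_ge0 ?sqr_ge0.
have z0 : 0 <= 2 * M * d by rewrite !mulr_ge0// ltW.
have int_indic (r : R) (D : set (planeR R)) : 0 <= r -> measurable D ->
    (\int[P]_x (r * \1_D x)%:E = r%:E * P D)%E.
  move=> r0 mD; under eq_integral do rewrite EFinM.
  rewrite ge0_integralZl//; last first.
    by apply/measurable_EFinP; exact: measurable_indic.
  by rewrite integral_indic// setIT.
have mi (r : R) (D : set (planeR R)) : measurable D ->
    measurable_fun [set: planeR R] (fun x => (r * \1_D x)%:E).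
  by move=> mD; apply/measurable_EFinP; apply: measurable_funM.
have ms (u : 'I_k -> R * R) := measurable_sqdist u.
have s0 (u : 'I_k -> R * R) := sqdist_ge0 u.
have i_ge0 (r : R) (D : set (planeR R)) : 0 <= r -> forall x, (0 <= (r * \1_D x)%:E)%E.
  by move=> r0 x; rewrite lee_fin mulr_ge0.
have mh (u : 'I_k -> R * R) : measurable_fun [set: planeR R]
    (fun x : planeR R => (2^-1)%:E * sqdist u x)%E.
  exact: measurable_funeM.
have h0 (u : 'I_k -> R * R) x : (0 <= (2^-1)%:E * sqdist u x)%E.
  exact: mule_ge0.
have int_half (u : 'I_k -> R * R) :
    (\int[P]_x ((2^-1)%:E * sqdist u x) = (2^-1)%:E * \int[P]_x sqdist u x)%E.
  by rewrite ge0_integralZl.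
have lhsE : (\int[P]_x (sqdist mid x +
      (4^-1 * enorm (c i0 - c' i0) ^+ 2 * \1_A x)%:E) =
    \int[P]_x sqdist mid x + (4^-1 * enorm (c i0 - c' i0) ^+ 2)%:E * P A)%E.
  rewrite ge0_integralD//; [|by move=> x _; exact: i_ge0|exact: mi].
  by rewrite int_indic.
have rhsE : (\int[P]_x ((2^-1)%:E * sqdist c x + (2^-1)%:E * sqdist c' x +
      (2 * M * d * \1_Z x)%:E) =
    (2^-1)%:E * \int[P]_x sqdist c x + (2^-1)%:E * \int[P]_x sqdist c' x +
      (2 * M * d)%:E * P Z)%E.
  rewrite ge0_integralD//; last 4 first.
  - by move=> x _; exact: adde_ge0.
  - exact: emeasurable_funD.
  - by move=> x _; exact: i_ge0.
  - exact: mi.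
  by rewrite ge0_integralD// int_indic// !int_half.
apply: (@le_trans _ _ (\int[P]_x sqdist mid x +
    (4^-1 * enorm (c i0 - c' i0) ^+ 2)%:E * P A)%E).
  apply: leeD2l; rewrite EFinM; apply: lee_wpmul2l; first by rewrite lee_fin.
  apply: le_trans (mean_ball_mass_ge i0).
  by rewrite lee_fin ler_wpM2l// divr_ge0.
rewrite -lhsE.
apply: (@le_trans _ _ (\int[P]_x ((2^-1)%:E * sqdist c x +
    (2^-1)%:E * sqdist c' x + (2 * M * d * \1_Z x)%:E))%E); last first.
  rewrite rhsE; apply: leeD2l; rewrite [leRHS]EFinM.
  apply: lee_wpmul2l; first by rewrite lee_fin.
  apply: bisector_zone_mass_le => // i j ij.
  by apply: lt_le_trans (near_means_sep cm ij); rewrite mulr_gt0// divr_gt0.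
(* The pointwise inequality is known for [enorm x <= M] only; the complement of this ball is a null
   set. *)
apply: ae_ge0_le_integral => //.
- by move=> x _; apply: adde_ge0 => //; exact: i_ge0.
- by apply: emeasurable_funD => //; exact: mi.
- by move=> x _; apply: adde_ge0; [exact: adde_ge0|exact: i_ge0].
- by apply: emeasurable_funD; [exact: emeasurable_funD|exact: mi].
exists (~` (eball (0 : R * R) M : set (planeR R))); split.
- by apply: measurableC; exact: measurable_eball.
- exact: mass_outside_ball.
- move=> x /= /not_implyP[_ nle] xM; apply: nle; apply: sqdist_mid_le.
  by move: xM; rewrite /eball/= subr0.
Qed.

End strict_convexity.

Lemma optimal_near_means_unique (c c' : 'I_k -> R * R) :
  optimal P c -> optimal P c' -> near_means c -> near_means c' -> c = c'.
Proof.
move=> copt copt' cm cm'.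
(* The largest displacement controls the loss for all indices, while the gain at [i0] is a multiple
   of its square. *)
pose i0 := [arg max_(i > Ordinal k_gt0) enorm (c i - c' i)]%O.
have i0_max i : enorm (c i - c' i) <= enorm (c i0 - c' i0).
  by rewrite /i0; case: arg_maxP => // j _; exact.
have [d0|d_gt0] := leP (enorm (c i0 - c' i0)) 0.
  apply/funext => i; apply/eqP; rewrite -subr_eq0; apply/eqP/enorm_eq0.
  by apply: le_anti; rewrite enorm_ge0 andbT (le_trans (i0_max i)).
exfalso; have mid_le := risk_mid_le cm cm' i0_max i0.
rewrite -/(risk P c) -/(risk P c') in mid_le.
have eq_risk : risk P c' = risk P c by apply: le_anti; rewrite copt copt'.
have {mid_le} := le_trans (leeD2r _ (copt _)) mid_le; rewrite eq_risk.
(* The common risk is finite, hence cancels from both sides. *)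
have := optimal_risk_le copt; rewrite -/(risk P c).
have : (0 <= risk P c)%E by apply: integral_ge0 => x _; exact: sqdist_ge0.
case: (risk P c) => [r| |]// _ _.
rewrite -!EFinM -!EFinD lee_fin => le_r.
by apply: (contraction_absurd tmin_gt0 d_gt0 M_gt0 B_gt0); lra.
Qed.

(** A code point close to two means would put these within [B / 8] of each other. The choice of a
    close code point for each mean is thus injective on ['I_k], hence a permutation. *)
Lemma optimal_near_means_perm (c : 'I_k -> R * R) : optimal P c ->
  exists s : {perm 'I_k}, near_means (c \o s).
Proof.
move=> copt; have /choice[f fP] i := optimal_near_mean i copt.
suff f_inj : injective f by exists (perm f_inj) => i; rewrite /= permE.
move=> i j fij; apply/eqP; apply: contraT => ij.
have := mean_sep_ge ij; have := fP i; have := fP j; rewrite -fij.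
have := ler_enorm_distD (c (f i)) (m i) (m j).
by rewrite (enorm_distC (m i) (c (f i))); have := B_gt0; lra.
Qed.

Lemma optimal_comp_perm (c : 'I_k -> R * R) (s : {perm 'I_k}) :
  optimal P c -> optimal P (c \o s).
Proof.
move=> copt c'; rewrite (_ : risk P (c \o s) = risk P c)//.
apply: eq_integral => x _; rewrite -!/(sqdist _ _).
apply: le_anti; apply/andP; split; apply: sqdist_subcode => // i.
- by exists ((s^-1)%g i); rewrite /= permKV.
- by exists (s i).
Qed.

(** * The margin quantities, computed from one optimal codebook *)

Section optimal_codebook.
Variable c0 : 'I_k -> R * R.
Hypotheses (c0_opt : optimal P c0) (c0_near : near_means c0).

Lemma optimalE (c : 'I_k -> R * R) : optimal P c ->
  exists s : {perm 'I_k}, c = c0 \o s.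
Proof.
move=> copt; have [s cs] := optimal_near_means_perm copt.
exists (s^-1)%g; rewrite -(optimal_near_means_unique (optimal_comp_perm s copt)
  c0_opt cs c0_near).
by apply/funext => i; rewrite /= permKV.
Qed.

Lemma finite_optimal : finite_set (optimal (k := k) P).
Proof.
apply: (@sub_finite_set _ _ (range (fun s : {perm 'I_k} => c0 \o s))).
  by move=> c /optimalE[s ->]; exists s.
exact/finite_image/finite_finset.
Qed.

Lemma sepB_ge : 7 / 8 * B <= sepB k P.
Proof.
apply: lb_le_inf.
  exists (enorm (c0 (Ordinal k_gt0) - c0 (Ordinal k_gt1))).
  by exists c0, (Ordinal k_gt0), (Ordinal k_gt1).
move=> _ [c [i [j [/optimalE[s ->] ij ->]]]].
by apply: (near_means_sep c0_near); rewrite (inj_eq perm_inj).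
Qed.

Lemma pmin_ge : 99 / 100 * tmin <= pmin k P.
Proof.
apply: lb_le_inf.
  by exists (fine (P (voronoi c0 (Ordinal k_gt0)))), c0, (Ordinal k_gt0).
move=> _ [c [i [/optimalE[s ->] ->]]].
have mV := measurable_voronoi (c0 \o s) i.
rewrite -lee_fin fineK ?fin_num_measure//.
apply: (@le_trans _ _ (P (eball (m (s i)) (B / 4)))).
  apply: le_trans (mean_ball_mass_ge (s i)).
  by rewrite lee_fin ler_wpM2l ?divr_ge0.
apply: le_measure; rewrite ?inE//; first exact: measurable_eball.
move=> x xi j ji /=; apply/ltW/(near_means_cell c0_near xi).
by rewrite (inj_eq perm_inj).
Qed.

Lemma Nstar_equidistant y : Nstar k P y -> exists i j,
  [/\ i != j, enorm (y - c0 i) = enorm (y - c0 j) &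
      forall l, enorm (y - c0 i) <= enorm (y - c0 l)].
Proof.
move=> [c [i [j [/optimalE[s ->] ij [Vi Vj]]]]].
exists (s i), (s j); split; first by rewrite (inj_eq perm_inj).
  by apply: le_anti; rewrite (Vi j) 1?eq_sym// (Vj i).
move=> l; have [->//|li] := eqVneq l (s i).
have := Vi ((s^-1)%g l); rewrite /= permKV; apply.
by apply: contra li => /eqP <-; rewrite permKV.
Qed.

Lemma Nstar_far y l : Nstar k P y -> 3 / 8 * B <= enorm (y - m l).
Proof.
move=> /Nstar_equidistant[i [j [ij yij yl]]].
have := near_means_sep c0_near ij; have := yl l; have := c0_near l.
have := ler_enorm_distD y (c0 i) (c0 j).
have := ler_enorm_distD (m l) y (c0 l).
by rewrite (enorm_distC (c0 i) y) (enorm_distC (m l) (c0 l)) -yij; lra.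
Qed.

Lemma Nstar_nbh_sub t w : t <= B / 8 -> t < w ->
  Nstar_nbh k P t `&` eball (0 : R * R) M `<=` bisector_zone c0 w.
Proof.
move=> tB tw x [xt]; rewrite /eball/= subr0 => xM; split=> //.
  (* A nearest point of [Nstar] may not exist; a point at distance less than [t + e] gives
     [B / 4 - e] for every [e > 0]. *)
  move=> l; apply/ler_addgt0Pr => e e0.
  have [y yN xy] : exists2 y, Nstar k P y & enorm (x - y) < t + e.
    by apply: set_dist_le_ex xt _; rewrite ltrDl.
  have := Nstar_far l yN; have := ler_enorm_distD x y (m l).
  by rewrite (enorm_distC y x); lra.
have [y /Nstar_equidistant[i [j [ij yij _]]] xy] := set_dist_le_ex xt tw.
by exists i, j; split=> //; apply: sqr_enorm_bisector_le yij (ltW xy).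
Qed.

Lemma mass_near_le t w : 0 <= t -> t <= B / 8 -> t < w ->
  (mass_near k P t <= (tmin * B / (150 * M ^+ 2) * w)%:E)%E.
Proof.
move=> t0 tB tw; pose D : set (planeR R) := eball (0 : R * R) M.
have mD : measurable D by exact: measurable_eball.
have mN : measurable (Nstar_nbh k P t : set (planeR R)).
  exact: measurable_set_dist_le.
have mZ : measurable (bisector_zone c0 w : set (planeR R)).
  exact: measurable_bisector_zone.
apply: (@le_trans _ _ (P (bisector_zone c0 w) + P (~` D))%E).
  apply: (@le_trans _ _ (P ((bisector_zone c0 w : set (planeR R)) `|` ~` D))).
    apply: le_measure; rewrite ?inE//.
      by apply: measurableU => //; exact: measurableC.
    move=> x xN; have [xD|xD] := pselect (D x); last by right.
    by left; apply: (Nstar_nbh_sub tB tw).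
  by apply: measureU2 => //; exact: measurableC.
rewrite [P (~` D)]mass_outside_ball adde0.
apply: bisector_zone_mass_le; first exact: le_trans (ltW tw).
by move=> i j ij; apply: lt_le_trans (near_means_sep c0_near ij); rewrite mulr_gt0.
Qed.

End optimal_codebook.

Lemma msupport_sub : msupport P `<=` eball (0 : R * R) M.
Proof.
move=> x xP; rewrite /eball/= subr0 leNgt; apply/negP => xM.
have r0 : 0 < (enorm x - M) / 2 by lra.
suff xr0 : P (eball x ((enorm x - M) / 2)) = 0%E.
  by have := xP _ r0; rewrite xr0 ltxx.
apply: (subset_measure0 _ _ _ mass_outside_ball).
- exact: measurable_eball.
- by apply: measurableC; exact: measurable_eball.
move=> y; rewrite /eball/= subr0 => yx yM.
have := ler_enorm_distD y x 0; rewrite !subr0 (enorm_distC x y).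
by lra.
Qed.

Lemma separated_mixture_margin : margin_condition k P M (B / 8).
Proof.
split; first exact: msupport_sub.
  have [->|/set0P[c copt]] := eqVneq (optimal (k := k) P) set0.
    exact: finite_set0.
  have [s cs] := optimal_near_means_perm copt.
  exact: finite_optimal (optimal_comp_perm s copt) cs.
move=> t /andP[t0 tB].
(* Without optimal codebooks both sides vanish: [sepB] is the infimum of the empty set, and every
   point is at distance [+oo] from [Nstar]. *)
have [opt0|/set0P[c copt]] := eqVneq (optimal (k := k) P) set0.
  have -> : sepB k P = 0.
    rewrite /sepB (_ : [set b | _] = set0) ?inf0//.
    by apply/seteqP; split=> // b [c [i [j []]]]; rewrite opt0.
  rewrite !mul0r /mass_near (_ : Nstar_nbh k P t = set0) ?measure0//.
  have t1 : t < t + 1 by rewrite ltrDl.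
  apply/seteqP; split=> // x xt.
  by have [y [c [i [j []]]]] := set_dist_le_ex xt t1; rewrite opt0.
have [s cs] := optimal_near_means_perm copt.
have c_opt := optimal_comp_perm s copt.
have M2 : 0 < M ^+ 2 by exact: exprn_gt0.
(* The estimate of [mass_near] asks for a width strictly above [t]; the width [t + e / K] raises the
   bound by exactly [e]. *)
apply/lee_addgt0Pr => e e0.
pose K := tmin * B / (150 * M ^+ 2).
have K0 : 0 < K by rewrite divr_gt0 ?mulr_gt0.
have t_lt : t < t + e / K by rewrite ltrDl divr_gt0.
apply: le_trans (mass_near_le c_opt cs t0 tB t_lt) _.
rewrite -EFinD lee_fin -/K mulrDr [K * (e / K)]mulrC divfK ?gt_eqF//.
rewrite lerD2r; apply: ler_wpM2r => //.
(* The constant [150] is explained here: [7 / 8 * (99 / 100) * 150] is slightly above [128]. *)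
have := sepB_ge c_opt cs; have := pmin_ge c_opt cs => hp hB.
rewrite /K !ler_pdivlMr ?mulr_gt0// mulrAC ler_pdivrMr ?mulr_gt0//.
have : 7 / 8 * B * (99 / 100 * tmin) <= sepB k P * pmin k P.
  by apply: ler_pM => //; rewrite mulr_ge0 ?divr_ge0// ltW.
have : 0 <= tmin * B by rewrite mulr_ge0// ltW.
move=> h1 h2; have := ler_wpM2r (ltW M2) h2; have := mulr_ge0 h1 (ltW M2).
by lra.
Qed.

End separated_mixture.

(** * From the threshold on the weights to the noise and overlap conditions *)

Unset Implicit Arguments.

Theorem proposition3p2 (R : realType) (k : nat)
    (theta : 'I_k -> R) (m : 'I_k -> R * R) (sigma M eps : R)
    (P : probability (planeR R) R)
    (sigma_gt0 : 0 < sigma) (M_gt0 : 0 < M)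
    (theta_ge0 : forall i, 0 <= theta i)
    (theta_sum1 : \sum_(i < k) theta i = 1)
    (P_mixture : is_quasi_gaussian_mixture theta m sigma M P)
    (eps_itv : 0 <= eps <= 1)
    (N_ge : forall i, 1 - eps <= truncation_mass m sigma M i)
    (ball_sub : forall i,
       eball (m i) (mean_sep m / 3) `<=` eball (0 : R * R) M)
    (ratio_ge : (weight_threshold m sigma M eps <=
                 (theta_min theta / theta_max theta)%:E)%E) :
  margin_condition k P M (mean_sep m / 8).
Proof.
have /andP[eps_ge0 eps_le1] := eps_itv.
have v_gt0 : 0 < sigma ^+ 2 by exact: exprn_gt0.
have k_gt0 : (0 < k)%N.
  rewrite lt0n; apply/eqP => k0; move: theta_sum1; rewrite big1 => [|i _].
    by move/esym/eqP; rewrite oner_eq0.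
  by have := leq_ltn_trans (leq0n i) (ltn_ord i); rewrite [X in (_ < X)%N]k0.
have kR_gt0 : 0 < k%:R :> R by rewrite ltr0n.
have B_ge0 := mean_sep_ge0 m.
set B := mean_sep m in B_ge0 ratio_ge ball_sub *.
have e_ge0 : 0 <= 1 - eps by rewrite subr_ge0.
(* The closing tactics would otherwise evaluate the unary numeral 2048. *)
have [big bigE] : exists b : R, b = 2048 by exists 2048.
have big_gt0 : 0 < big by rewrite bigE ltr0n.
have exp_le1 : expR (- (B ^+ 2 / (big * sigma ^+ 2))) <= 1.
  by rewrite -expR0 ler_expR oppr_le0 divr_ge0 ?sqr_ge0// mulr_ge0// ltW.
have exp_ge1 : 1 <= expR (B ^+ 2 / (32 * sigma ^+ 2)).
  by rewrite -expR0 ler_expR divr_ge0 ?sqr_ge0// mulr_ge0// ltW.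
have num1 : 0 < big * k%:R * sigma ^+ 2 by rewrite !mulr_gt0.
move: ratio_ge; rewrite /weight_threshold -/B -bigE ge_max.
move=> /andP[noise overlap].
have [||den1 noise'] := lee_div_fin _ _ noise => //.
  by rewrite mulr_ge0 ?subr_ge0// mulr_ge0 ?sqr_ge0.
have [||den2 overlap'] := lee_div_fin _ _ overlap.
- by rewrite mulr_gt0 ?exprn_gt0// mulr_gt0 ?exprn_gt0.
- by rewrite mulr_ge0 ?subr_ge0// mulr_ge0// !mulr_ge0// ltW.
have B_gt0 : 0 < B.
  rewrite lt_neqAle B_ge0 andbT; apply/eqP => B0.
  by move: den2; rewrite -B0 mulr0 mul0r ltxx.
have eps_lt1 : eps < 1.
  rewrite -subr_gt0 lt_neqAle e_ge0 andbT; apply/eqP => e0.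
  by move: den2; rewrite -e0 !mul0r ltxx.
have k_gt1 : (1 < k)%N by exact: mean_sep_gt0_card B_gt0.
have tmin_le := theta_min_le theta_ge0.
have tmax_ge := theta_max_ge theta_ge0.
have tmax_gt0 : 0 < theta_max theta.
  rewrite ltNge; apply/negP => tmax0; suff : \sum_(i < k) theta i <= 0.
    by rewrite theta_sum1 ler10.
  by apply: sumr_le0 => i _; exact: le_trans (tmax_ge i) _.
(* The ratio of the weights, multiplied by a positive denominator, dominates the positive first
   numerator. *)
have tmin_gt0 : 0 < theta_min theta.
  have := lt_le_trans num1 noise'; rewrite pmulr_lgt0//.
  by rewrite pmulr_lgt0 ?invr_gt0.
(* The factor [1 - expR _] of the threshold is bounded by [1]; likewise, [expR _ - 1] is bounded by
   [expR _] in the next inequality. *)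
have noise_small : 2048 * k%:R * sigma ^+ 2 * theta_max theta <=
    theta_min theta * ((1 - eps) * B ^+ 2).
  rewrite -bigE -ler_pdivlMr// (le_trans noise')// mulrAC.
  rewrite ler_wpM2r ?invr_ge0 ?(ltW tmax_gt0)// ler_wpM2l ?(ltW tmin_gt0)//.
  rewrite ler_piMr ?mulr_ge0 ?sqr_ge0// lerBlDr lerDl expR_ge0.
have overlap_small : 2048 * k%:R ^+ 2 * M ^+ 3 * theta_max theta <=
    theta_min theta *
      ((1 - eps) * 7 * sigma ^+ 2 * B * expR (B ^+ 2 / (32 * sigma ^+ 2))).
  rewrite -bigE -ler_pdivlMr// (le_trans overlap')// mulrAC.
  rewrite ler_wpM2r ?invr_ge0 ?(ltW tmax_gt0)// ler_wpM2l ?(ltW tmin_gt0)//.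
  by rewrite ler_wpM2l ?lerBlDr ?lerDl// !mulr_ge0// ltW.
exact: (separated_mixture_margin sigma_gt0 M_gt0 B_gt0 k_gt1 eps_ge0 eps_lt1
  tmin_gt0 tmin_le tmax_ge theta_sum1 P_mixture N_ge (mean_sep_le m) ball_sub
  noise_small overlap_small).
Qed.
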